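(* Assume $F\in\mathcal{D}(G_\gamma)$ for some $\gamma\in\mathbb{R}$. Furthermore assume that the tail quantile function $U$ satisfies the second order conditions (SO) of the context (with this $\gamma$ and some $\rho\le0$). Define $$G_{n,k}:=\frac{\hat{x}^F-X_{n-k,n}}{X_{n-k,n}-X_{n-2k,n}},\qquad G^*_{n,k}(0):=\log 2\;G_{n,k}-\Bigl(\log k+\frac{\log 2}{2}\Bigr).$$ If $k=k_n$ is an intermediate sequence of positive integers ($k_n\to\infty$, $k_n/n\to0$) such that $\sqrt{k}\,A_0(n/k)\to\lambda^*\in\mathbb{R}$ as $n\to\infty$, then, as $n\to\infty$, \begin{itemize} \item if $\gamma=0$, $G^*_{n,k}(0)\stackrel{d}{\longrightarrow}Z$, where $Z$ has the Gumbel distribution function $\Lambda(x)=\exp\{-e^{-x}\}$, $x\in\mathbb{R}$; \item if $\gamma>0$, $G^*_{n,k}(0)\stackrel{P}{\longrightarrow}+\infty$; \item if $\gamma<0$, $G^*_{n,k}(0)\stackrel{P}{\longrightarrow}-\infty$. \end{itemize}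
   Context: Setting: $X_1,X_2,\ldots$ are i.i.d. with distribution function $F$; $X_{1,n}\le\cdots\le X_{n,n}$ are the ascending order statistics of $X_1,\ldots,X_n$. $U(t):=F^{\leftarrow}(1-1/t)$, $t>1$ (generalized inverse). $F\in\mathcal{D}(G_\gamma)$ means there are $a_n>0$, $b_n\in\mathbb{R}$ with $F^n(a_nx+b_n)\to G_\gamma(x)=\exp\{-(1+\gamma x)^{-1/\gamma}\}$, $1+\gamma x>0$ (read as $\exp(-e^{-x})$ if $\gamma=0$); equivalently, there is a positive measurable $a(\cdot)$ with $\lim_{t\to\infty}(U(tx)-U(t))/a(t)=(x^\gamma-1)/\gamma$ for all $x>0$ (read as $\log x$ if $\gamma=0$). General endpoint statistic (defined for every $\gamma$): $$\hat{x}^F:=X_{n,n}+X_{n-k,n}-\frac{1}{\log 2}\sum_{i=0}^{k-1}\log\Bigl(1+\frac{1}{k+i}\Bigr)X_{n-k-i,n}.$$ Second order conditions (SO): there is a positive or negative function $A_0$ with $\lim_{t\to\infty}A_0(t)=0$ such that, for each $x>0$, $$\lim_{t\to\infty}\frac{\frac{U(tx)-U(t)}{a_0(t)}-\frac{x^\gamma-1}{\gamma}}{A_0(t)}=\Psi^\star_{\gamma,\rho}(x),$$ where $\rho\le0$, $$\Psi^\star_{\gamma,\rho}(x):=\begin{cases}\frac{x^{\gamma+\rho}-1}{\gamma+\rho},&\gamma+\rho\ne0,\ \rho<0,\\ \log x,&\gamma+\rho=0,\ \rho<0,\\ \frac1\gamma x^\gamma\log x,&\rho=0\ne\gamma,\\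 \frac12(\log x)^2,&\gamma=\rho=0,\end{cases}\qquad a_0(t):=\begin{cases}a(t)(1-A_0(t)),&\rho<0,\\ a(t)(1-A_0(t)/\gamma),&\rho=0\ne\gamma,\\ a(t),&\gamma=\rho=0.\end{cases}$$ Moreover $|A_0|$ is regularly varying with index $\rho$ and, for all $x>0$, $$\lim_{t\to\infty}\frac{\frac{a_0(tx)}{a_0(t)}-x^\gamma}{A_0(t)}=x^\gamma\,\frac{x^\rho-1}{\rho}$$ (with $(x^\gamma-1)/\gamma$ read as $\log x$ if $\gamma=0$ and $(x^\rho-1)/\rho$ read as $\log x$ if $\rho=0$). Convergence in probability to $\pm\infty$ has the usual meaning: for every $M$, the probability of exceeding $M$ (respectively, of being below $-M$) tends to $1$. *)

(* Defs.v *)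
From HB Require Import structures.
From mathcomp Require Export all_boot all_order all_algebra.
From mathcomp Require Export finmap.
From mathcomp Require Export all_classical all_reals all_analysis.

Set Implicit Arguments.
Unset Strict Implicit.
Unset Printing Implicit Defensive.

Export Order.TTheory GRing.Theory Num.Theory numFieldNormedType.Exports.

#[global] Open Scope classical_set_scope.
#[global] Open Scope ring_scope.

Section ExtremeValues.
Variable R : realType.
Implicit Types (F U a f : R -> R) (gamma rho x t : R).

Definition gumbel_cdf x : R := expR (- expR (- x)).

(* Only meaningful where 0 < 1 + gamma * x. *)
Definition gev_cdf gamma x : R :=
  if gamma == 0 then gumbel_cdf x
  else expR (- (1 + gamma * x) `^ (- gamma^-1)).

Definition box_cox gamma x : R :=
  if gamma == 0 then ln x else (x `^ gamma - 1) / gamma.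

(* The left-continuous inverse of F at 1 - 1/t; the set is nonempty and bounded
   below when F is a distribution function and 1 < t. *)
Definition tail_quantile F t : R := inf [set x | 1 - t^-1 <= F x].

Definition domain_of_attraction F gamma : Prop :=
  exists c b : nat -> R,
    (forall n, 0 < c n) /\
    forall x, 0 < 1 + gamma * x ->
      F (c n * x + b n) ^+ n @[n --> \oo] --> gev_cdf gamma x.

(* U is defined on ]1, +oo[, so conditions on auxiliary functions are imposed
   there only. *)
Definition first_order U gamma a : Prop :=
  [/\ forall t, 1 < t -> 0 < a t,
      measurable_fun (`]1, +oo[ : set R) a
    & forall x, 0 < x ->
        (U (t * x) - U t) / a t @[t --> +oo] --> box_cox gamma x].

(* For rho < 0 the two subcases gamma + rho <> 0 and gamma + rho = 0 are those
   of box_cox. *)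
Definition Psi_star gamma rho x : R :=
  if rho < 0 then box_cox (gamma + rho) x
  else if gamma != 0 then gamma^-1 * x `^ gamma * ln x
  else 2^-1 * ln x ^+ 2.

Definition scale0 gamma rho a (A0 : R -> R) t : R :=
  if rho < 0 then a t * (1 - A0 t)
  else if gamma != 0 then a t * (1 - A0 t / gamma)
  else a t.

Definition regularly_varying f rho : Prop :=
  [/\ measurable_fun (`]1, +oo[ : set R) f,
      \forall t \near +oo, 0 < f t
    & forall x, 0 < x -> f (t * x) / f t @[t --> +oo] --> x `^ rho].

(* The relation (a0 (t x) / a0 t - x^gamma) / A0 t --> x^gamma (x^rho - 1) / rho,
   often listed next to these conditions, is not required.  Comparing the
   expansions of U (t x y) - U t, U (t x) - U t and U (t x y) - U (t x) shows
   that it follows from the last clause when rho = 0 (with ln x for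
   (x^rho - 1) / rho); for this a0 and rho < 0 the same computation gives the
   limit 0, so that imposing it would exclude every rho < 0. *)
Definition second_order U gamma rho a (A0 : R -> R) : Prop :=
  [/\ (forall t, 1 < t -> 0 < A0 t) \/ (forall t, 1 < t -> A0 t < 0),
      A0 t @[t --> +oo] --> 0,
      regularly_varying (fun t => `|A0 t|) rho
    & forall x, 0 < x ->
        ((U (t * x) - U t) / scale0 gamma rho a A0 t - box_cox gamma x) / A0 t
          @[t --> +oo] --> Psi_star gamma rho x].

End ExtremeValues.

Section Probability.
Context {d : measure_display} {T : measurableType d} {R : realType}.
Variable P : probability T R.

Definition mutually_independent (X : nat -> {RV P >-> R}) : Prop :=
  forall (J : {fset nat}) (B : nat -> set R), (forall i, measurable (B i)) ->
    P (\bigcap_(i in [set` J]) (X i @^-1` B i)) =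
    (\prod_(i <- J) P (X i @^-1` B i))%E.

Definition iid (X : nat -> {RV P >-> R}) (F : R -> R) : Prop :=
  mutually_independent X /\ forall i x, cdf (X i) x = (F x)%:E.

Definition cvg_in_distribution (Y : nat -> T -> R) (H : R -> R) : Prop :=
  forall x, {for x, continuous H} ->
    P [set w | Y n w <= x] @[n --> \oo] --> (H x)%:E.

Definition cvg_in_probability_pinfty (Y : nat -> T -> R) : Prop :=
  forall M : R, P [set w | M < Y n w] @[n --> \oo] --> 1%E.

Definition cvg_in_probability_ninfty (Y : nat -> T -> R) : Prop :=
  forall M : R, P [set w | Y n w < - M] @[n --> \oo] --> 1%E.

End Probability.

Section EndpointStatistics.
Context {T : Type} {R : realType}.
Variable X : nat -> T -> R.
Implicit Types (n j k : nat) (w : T).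

(* X_{j,n}, the j-th smallest of the n first variables X 0, ..., X n.-1; the
   rank j ranges over 1, ..., n. *)
Definition order_stat j n w : R :=
  nth 0 (sort <=%O [seq X i w | i <- iota 0 n]) j.-1.

Definition endpoint_stat n k w : R :=
  order_stat n n w + order_stat (n - k) n w
  - (ln 2)^-1 *
    \sum_(0 <= i < k) ln (1 + (k + i)%:R^-1) * order_stat (n - k - i) n w.

Definition G_stat n k w : R :=
  (endpoint_stat n k w - order_stat (n - k) n w) /
  (order_stat (n - k) n w - order_stat (n - 2 * k) n w).

Definition G_star0 n k w : R :=
  ln 2 * G_stat n k w - (ln k%:R + ln 2 / 2).

End EndpointStatistics.

(* Main.v *)
Require Import Defs.
From mathcomp Require Import ring lra measurable_realfun.

Set Implicit Arguments.
Unset Strict Implicit.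
Unset Printing Implicit Defensive.

(** Let X_{j,n} be the order statistics, U the tail quantile function and Den the
    difference X_{n-k,n} - X_{n-2k,n}.  The weights log (1 + 1/(k+i)) sum to log 2,
    hence
      log 2 * G_{n,k} = (log 2 * (X_{n,n} - X_{n-k,n}) + S) / Den,
    where S is the weighted sum of the distances X_{n-k,n} - X_{n-k-i,n}
    ([G_star0E]).  Two scales are compared.  The order statistics of ranks about
    n - k concentrate at deterministic points: counting the observations above
    U t, a binomial number of mean about n/t, and applying Chebyshev's inequality
    places X_{n-r,n} near U (n/r).  The relative error in the argument may be of any
    order above k^(-1/2) for single ranks ([whp_band]), and arbitrarily small but
    fixed for all k <= r <= 2k at once ([whp_profile]).  The maximum remains random:
    P (X_{n,n} <= U (n e^x)) tends to exp (- e^(-x)) ([prob_max_le_limit],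
    [prob_max_lt_limit]).  So the statistic is essentially a function of the
    maximum, and its limit law follows from the behaviour of the increments of U
    between n/(2k), n/k and n e^x.  As F need not be continuous, all of this is
    done with one-sided bounds at the points U t rather than by representing the
    sample as U of a Pareto sample.

    If gamma <> 0, S / Den lies in [0, log 2] and only the ratio
    (U (n e^x) - U (n/k)) / (U (n/k) - U (n/(2k))) matters.  Increments of
    W x = U (e^x) over consecutive unit intervals have ratios tending to e^gamma.
    Over the range log k + x from log (n/k) to log n + x they therefore grow
    geometrically when gamma > 0, and the ratio beats log k
    ([far_increment_large]); they are summable when gamma < 0, and the ratio stays
    bounded while log k is subtracted ([far_increment_small]).

    If gamma = 0, with alpha = a_0 (n/k) the expected values are alpha * (log k + x)
    for the distance from U (n/k) to U (n e^x), alpha * log 2 for Den, and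
    alpha * (log 2)^2 / 2 for S, a Riemann sum ([sum_weight_log]).  This gives
    G* = x up to errors.  But Den is divided into a quantity of order log k, so its
    relative error has to be o(1 / log k), although X_{n-k,n} and X_{n-2k,n} are
    random; this is where the second-order condition enters.  It is a pointwise
    limit in x, whereas a uniform bound is needed at moving points.  The uniform
    convergence theorem supplies it ([uniform_increments]): W is monotone, hence
    measurable, and |A_0| is measurable, so Egorov's theorem yields auxiliary
    points that are good for two base points simultaneously, and comparing the
    expansions from both gives
      |W (x + v) - W x - alpha v| <= K alpha |A_0|  for all |v| <= 1.
    Summing this over about log k unit steps, during which |A_0| grows by at most
    e^(1/4) per step and starts at order k^(-1/2), gives the increment up to
    n e^x with error o(alpha) ([far_increment]). *)

(** * Avoiding small sets on the line *)

Section GoodPoints.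
Variable R : realType.
Implicit Types (u v : R) (B : nat -> set R).
Notation mu := (@lebesgue_measure R).

(** Both sides are measures in A that agree on the half-open intervals. *)
Lemma lebesgue_measure_shift v (A : set R) : measurable A ->
  mu [set u | A (u + v)] = mu A.
Proof.
move=> mA.
have mf : measurable_fun [set: R] (fun u => u + v) by apply: measurable_funD.
have -> : [set u | A (u + v)] = (fun u => u + v) @^-1` A by [].
rewrite -[LHS]/(pushforward mu ((fun u => u + v) : _ -> measurableTypeR R) A).
apply/esym/lebesgue_measure_unique => //= _ [[a b]] _ <-.
rewrite /pushforward.
have -> : (fun u => u + v) @^-1` `]a, b]%classic = `](a - v), (b - v)]%classic.
  by apply/seteqP; split=> u /=; rewrite !in_itv /= ltrBlDr lerBrDr.
rewrite !lebesgue_measure_itv /= !lte_fin ltrD2r; case: ifP => // _.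
by rewrite -!EFinB; congr EFin; ring.
Qed.

(** The sets B n need not decrease, but the unions of their tails do, and their
    intersection is empty because each point lies in finitely many of them. *)
Lemma bad_measure_cvg0 B : (forall n, measurable (B n)) ->
  (forall n, B n `<=` `[0, 3]) ->
  (forall u, `[0, 3]%classic u -> \forall n \near \oo, ~ B n u) ->
  mu (B n) @[n --> \oo] --> 0%E.
Proof.
move=> mB sB evB.
have cvgU : mu (\bigcup_(j >= n) B j) @[n --> \oo] --> mu (lim_sup_set B).
  apply: lim_sup_set_cvg => //.
  apply: (@le_lt_trans _ _ (mu `[0%R, 3%R])).
    apply: le_measure; rewrite ?inE; last by apply: bigcup_sub => i _; exact: sB.
      by apply: bigcup_measurable => i _; exact: mB.
    exact: measurable_itv.
  by rewrite lebesgue_measure_itv /= lte_fin ltr0n -EFinB ltry.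
have limsup0 : lim_sup_set B = set0.
  apply/seteqP; split=> // u Lu.
  have [j _ Bju] : (\bigcup_(j >= 0) B j) u by exact: Lu.
  have /evB [N _ HN] := sB _ _ Bju.
  have [i /= Ni Bi] : (\bigcup_(j >= N) B j) u by exact: Lu.
  by exact: (HN i).
rewrite limsup0 measure0 in cvgU.
apply: (squeeze_cvge _ (cvg_cst _) cvgU); apply: nearW => n.
rewrite measure_ge0 /=; apply: le_measure; rewrite ?inE.
- exact: mB.
- by apply: bigcup_measurable => i _; exact: mB.
by move=> u Bu; exists n => //=.
Qed.

(** By Egorov's theorem the four sets to be avoided have measure below 1/5 for
    large n, translation by v n does not change this, and u ranges over an
    interval of length 1.  The bound 3 leaves room for u + 1 + v n. *)
Lemma good_point B1 B2 (v : nat -> R) :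
  (forall n, measurable (B1 n)) -> (forall n, measurable (B2 n)) ->
  (forall n, B1 n `<=` `[0, 3]) -> (forall n, B2 n `<=` `[0, 3]) ->
  (forall u, `[0, 3]%classic u -> \forall n \near \oo, ~ B1 n u) ->
  (forall u, `[0, 3]%classic u -> \forall n \near \oo, ~ B2 n u) ->
  exists n, exists2 u, 0 <= u <= 1 &
    [/\ ~ B1 n (u + v n), ~ B1 n (u + 1 + v n), ~ B2 n u & ~ B2 n (u + 1)].
Proof.
move=> m1 m2 s1 s2 e1 e2.
have lt5 (B : nat -> set R) : mu (B n) @[n --> \oo] --> 0%E ->
    \forall n \near \oo, (mu (B n) < 5^-1%:E)%E.
  move=> /fine_cvgP[fB /cvgrPdist_lt /(_ 5^-1) H].
  have {}H := H ltac:(lra).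
  near=> n; rewrite -(@fineK _ (mu (B n))); last by near: n.
  rewrite lte_fin; apply: le_lt_trans (ler_norm _) _.
  by rewrite -normrN -[- _]add0r; near: n.
have [n [b1 b2]] : exists n, (mu (B1 n) < 5^-1%:E)%E /\ (mu (B2 n) < 5^-1%:E)%E.
  have := lt5 _ (bad_measure_cvg0 m1 s1 e1).
  have := lt5 _ (bad_measure_cvg0 m2 s2 e2).
  move=> [N2 _ H2] [N1 _ H1]; exists (maxn N1 N2); split.
    by apply: H1 => /=; exact: leq_maxl.
  by apply: H2 => /=; exact: leq_maxr.
exists n; apply: contrapT => Hno.
pose C1 := [set u | B1 n (u + v n)]; pose C2 := [set u | B1 n (u + (1 + v n))].
pose C3 := B2 n; pose C4 := [set u | B2 n (u + 1)].
have mC (B : set R) w : measurable B -> measurable [set u | B (u + w)].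
  move=> mB; rewrite -[X in measurable X]setTI.
  by apply: (_ : measurable_fun setT (fun u => u + w)) => //; exact: measurable_funD.
have sub : `[0%R, 1%R]%classic `<=` (C1 `|` C2) `|` (C3 `|` C4).
  move=> u /=; rewrite in_itv /= => u01; apply: contrapT => nC.
  apply: Hno; exists u => //; split => bad; apply: nC; [left; left|left; right|right; left|right; right] => //.
  by rewrite /C2 /= addrA.
have mC1 : measurable C1 by exact: mC.
have mC2 : measurable C2 by exact: mC.
have mC4 : measurable C4 by exact: mC.
have : (mu `[0%R, 1%R] <= (mu C1 + mu C2) + (mu C3 + mu C4))%E.
  apply: (le_trans (le_measure mu _ _ sub)).
  - by rewrite inE.
  - by rewrite inE; do 2 apply: measurableU => //; apply: m2.
  apply: (le_trans (measureU2 _ _ _)); [by apply: measurableU|apply: measurableU; [exact: m2|by []]|].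
  by apply: leeD; apply: measureU2 => //; apply: m2.
rewrite /C1 /C2 /C3 /C4 !lebesgue_measure_shift// lebesgue_measure_itv /= lte_fin ltr01.
apply/negP; rewrite -ltNge -EFinB subr0.
apply: (@lt_le_trans _ _ ((5^-1%:E + 5^-1%:E) + (5^-1%:E + 5^-1%:E))%E).
  by do ! apply: lteD.
by rewrite -!EFinD lee_fin; lra.
Unshelve. all: by end_near.
Qed.

End GoodPoints.

(** * Uniform convergence of second-order increments *)

(** Here w' and w stand for W (x + v) and W x, and w1, w2 for the values of W at
    two points one unit apart.  Both base points expand w2 - w1, and equating the
    two expansions bounds A' - A; expanding w1 from both then bounds w' - w. *)
Lemma increments_from_two_points (R : realFieldType) (w w' w1 w2 A A' b b' u v C r : R) :
  0 < A -> 0 < A' -> 0 < b -> 0 < b' -> 0 < C -> 0 <= u <= 1 ->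
  `|w1 - w - A * (u + v)| <= C * (A * b) ->
  `|w2 - w - A * (u + 1 + v)| <= C * (A * b) ->
  `|w1 - w' - A' * u| <= C * (A' * b') ->
  `|w2 - w' - A' * (u + 1)| <= C * (A' * b') ->
  b' <= r * b -> 6 * C * b <= 1 -> 6 * C * b' <= 1 ->
  `|w' - w - A * v| <= 3 * C * (1 + 2 * r) * (A * b) /\
  `|A' - A| <= 3 * C * (1 + 2 * r) * (A * b).
Proof.
move=> A0 A'0 b0 b'0 C0 /andP[u0 u1].
rewrite ler_norml => /andP[l1 r1]; rewrite ler_norml => /andP[l2 r2].
rewrite ler_norml => /andP[l3 r3]; rewrite ler_norml => /andP[l4 r4].
move=> b'b Cb Cb'.
set X := C * (A * b); set Y := C * (A' * b') in l3 r3 l4 r4 *.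
have X0 : 0 <= X by rewrite !mulr_ge0 // ltW.
have Y0 : 0 <= Y by rewrite !mulr_ge0 // ltW.
have YA : 6 * Y <= A'.
  have : A' * (6 * C * b') <= A' * 1 by rewrite ler_pM2l.
  by rewrite /Y; lra.
have XA : 6 * X <= A.
  have : A * (6 * C * b) <= A * 1 by rewrite ler_pM2l.
  by rewrite /X; lra.
rewrite -/X in l1 r1 l2 r2.
have dA : - (2 * X + 2 * Y) <= A' - A <= 2 * X + 2 * Y by apply/andP; split; lra.
case/andP: dA => dA1 dA2.
have A'A : A' <= 2 * A by lra.
have r0 : 0 <= r.
  have : 0 <= r * b by apply: le_trans b'b; exact: ltW.
  by rewrite pmulr_lge0.
(* The error at the second base point is comparable with that at the first. *)
have YX : Y <= 2 * r * X.
  have : A' * b' <= (2 * A) * (r * b) by apply: ler_pM => //; exact: ltW.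
  move=> /(ler_wpM2l (ltW C0)); rewrite -/Y => /le_trans; apply.
  by rewrite /X le_eqVlt; apply/orP; left; apply/eqP; ring.
have -> : 3 * C * (1 + 2 * r) * (A * b) = 3 * X + 6 * r * X by rewrite /X; ring.
(* Since 0 <= u <= 1, the factor u does not spoil the bound on A' - A. *)
have uA : - (2 * X + 2 * Y) <= (A' - A) * u <= 2 * X + 2 * Y.
  rewrite -ler_norml normrM (ger0_norm u0).
  apply: (@le_trans _ _ (`|A' - A| * 1)); first by rewrite ler_wpM2l.
  by rewrite mulr1 ler_norml dA1 dA2.
case/andP: uA => uA1 uA2.
have E : (A' - A) * u = A' * u - A * u by ring.
have E1 : A * (u + v) = A * u + A * v by ring.
rewrite E in uA1 uA2; rewrite E1 in l1 r1.
by split; rewrite ler_norml; apply/andP; split; lra.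
Qed.

Section UniformIncrements.
Variable R : realType.
Variables (W alpha beta : R -> R) (c C : R).

(** The second-order condition as it is used: a bound on the remainder in place
    of its limit, and the comparability of beta that regular variation provides. *)
Definition bounded_step (s u : R) :=
  [/\ `|W (s + u) - W s - alpha s * u| <= C * (alpha s * beta s),
      c * beta s <= beta (s + u) & beta (s + u) <= C * beta s].

Hypothesis W_nd : {in `]0, +oo[ &, {homo W : s t / s <= t}}.
Hypothesis mbeta : measurable_fun (`]0, +oo[ : set R) beta.

Lemma measurable_unbounded_step (s : R) : 0 < s ->
  measurable [set u | `[0, 3]%classic u /\ ~ bounded_step s u].
Proof.
move=> s0; set D := `[0, 3]%classic : set R.
have mD : measurable D by exact: measurable_itv.
have mW : measurable_fun D (fun u => W (s + u)).
  apply: (@eq_measurable_fun _ _ _ _ D (fun u => W (s + Num.max u 0))).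
    move=> u; rewrite inE /D /= in_itv /= => /andP[u0 _].
    by congr W; rewrite max_l.
  apply: nondecreasing_measurable => // x y xy; apply: W_nd.
  - by rewrite in_itv /= andbT ltr_wpDr // le_max lexx orbT.
  - by rewrite in_itv /= andbT ltr_wpDr // le_max lexx orbT.
  - by rewrite lerD2l ge_max !le_max xy lexx !orbT.
have mb : measurable_fun D (fun u => beta (s + u)).
  change (measurable_fun D (beta \o (fun u => s + u))).
  apply: (@measurable_comp _ _ _ _ _ _ (`]0, +oo[%classic : set R)) => //.
  
    move=> _ [u + <-]; rewrite /D /= !in_itv /= andbT => /andP[u0 _].
    by rewrite ltr_wpDr.
  by apply: measurable_funD => //; exact: measurable_cst.
have mQ : measurable_fun D (fun u => `|W (s + u) - W s - alpha s * u|).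
  apply: measurableT_comp => //; apply: measurable_funB.
    by apply: measurable_funB => //; exact: measurable_cst.
  by apply: measurable_funTS.
have -> : [set u | D u /\ ~ bounded_step s u] = D `\`
    ((D `&` (fun u => `|W (s + u) - W s - alpha s * u|) @^-1`
        `]-oo, C * (alpha s * beta s)]) `&`
     (D `&` (fun u => beta (s + u)) @^-1` `[c * beta s, C * beta s])).
  apply/seteqP; split=> u /=; rewrite !in_itv /=.
    move=> [Du nb]; split => // -[[_ b1] [_ /andP[b2 b3]]]; exact: nb.
  move=> [Du nb]; split => // -[b1 b2 b3]; apply: nb; split; split => //.
  by rewrite b2 b3.
apply: measurableD => //; apply: measurableI.
  by apply: mQ => //; exact: measurable_itv.
by apply: mb => //; exact: measurable_itv.
Qed.

Hypotheses (c_gt0 : 0 < c) (C_gt0 : 0 < C).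
Hypothesis alpha_gt0 : \forall s \near +oo, 0 < alpha s.
Hypothesis beta_gt0 : \forall s \near +oo, 0 < beta s.
Hypothesis beta_cvg0 : beta s @[s --> +oo] --> 0.
Hypothesis step : forall u, 0 <= u <= 3 -> \forall s \near +oo, bounded_step s u.

(** The uniform convergence theorem.  Were it false, it would fail along some
    s_n --> +oo and v_n in [0, 1].  By [good_point] the bounds hold at some u,
    together with u + 1, from both base points s_n and s_n + v_n, so that
    [increments_from_two_points] applies. *)
Lemma uniform_increments_right : exists K : R, \forall s \near +oo,
  forall v, 0 <= v <= 1 ->
  [/\ `|W (s + v) - W s - alpha s * v| <= K * (alpha s * beta s),
      `|alpha (s + v) - alpha s| <= K * (alpha s * beta s),
      beta (s + v) <= K * beta s & beta s <= K * beta (s + v)].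
Proof.
pose r := C / c.
have r0 : 0 < r by rewrite divr_gt0.
pose K := 3 * C * (1 + 2 * r) + r; exists K.
(* A failure of the claim yields sequences s n and v n along which it fails. *)
apply: contrapT => Hno.
have [S0 [_ HS0]] : \forall s \near +oo,
    [/\ 0 < alpha s, 0 < beta s & 6 * C * beta s <= 1].
  have e0 : 0 < (6 * C)^-1 by rewrite invr_gt0 mulr_gt0.
  near=> s; split; [by near: s|by near: s|].
  have b0 : 0 < beta s by near: s.
  rewrite -ler_pdivlMl ?mulr_gt0// mulr1 -[leLHS]gtr0_norm//.
  by near: s; exact: cvgr0_norm_le.
have ex n : exists p : R * R, [/\ n.+1%:R < p.1, S0 < p.1, 0 <= p.2 <= 1 &
    ~ [/\ `|W (p.1 + p.2) - W p.1 - alpha p.1 * p.2| <= K * (alpha p.1 * beta p.1),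
      `|alpha (p.1 + p.2) - alpha p.1| <= K * (alpha p.1 * beta p.1),
      beta (p.1 + p.2) <= K * beta p.1 & beta p.1 <= K * beta (p.1 + p.2)]].
  apply: contrapT => Hn; apply: Hno.
  exists (Num.max n.+1%:R S0); split; first exact: num_real.
  move=> s; rewrite gt_max => /andP[sn sS] v v01.
  by apply: contrapT => bad; apply: Hn; exists (s, v).
have [p Hp] := choice ex.
pose s n := (p n).1; pose v n := (p n).2.
have s_y : s n @[n --> \oo] --> +oo.
  apply/cvgryPge => M; near=> n; have [/ltW + _ _ _] := Hp n; apply: le_trans.
  apply: (@le_trans _ _ n%:R); last by rewrite ler_nat.
  by near: n; exact: nbhs_infty_ger.
have s_gt0 n : 0 < s n by have [+ _ _ _] := Hp n; apply: lt_trans.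
have v01 n : 0 <= v n <= 1 by have [_ _ + _] := Hp n.
have v_ge0 n : 0 <= v n by case/andP: (v01 n).
pose B (t : nat -> R) n := [set u | `[0, 3]%classic u /\ ~ bounded_step (t n) u].
have B_ev (t : nat -> R) : (forall n, s n <= t n) ->
    forall u, `[0, 3]%classic u -> \forall n \near \oo, ~ B t n u.
  move=> st u u03.
  have t_y : t n @[n --> \oo] --> +oo.
    by apply: ger_cvgy s_y; exact: nearW.
  have u03' : 0 <= u <= 3 by move: u03; rewrite /= in_itv.
  by near=> n => -[_]; apply; near: n; exact: (t_y _ (step u03')).
have B_sub (t : nat -> R) n : B t n `<=` `[0, 3] by move=> u [].
have mB (t : nat -> R) : (forall n, s n <= t n) -> forall n, measurable (B t n).
  by move=> st n; apply: measurable_unbounded_step; exact: lt_le_trans (s_gt0 n) (st n).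
(* The bounds are available from both base points s n and s n + v n. *)
pose s' n := s n + v n.
have ss' n : s n <= s' n by rewrite lerDl.
have [n [u u01 [b1 b2 b3 b4]]] := good_point v (mB s (fun=> lexx _)) (mB _ ss')
  (@B_sub s) (@B_sub s') (B_ev _ (fun=> lexx _)) (B_ev _ ss').
case/andP: (u01) (v01 n) => u0 u1 /andP[v0 v1].
have good (t : nat -> R) (w : R) : 0 <= w <= 3 -> ~ B t n w -> bounded_step (t n) w.
  by move=> w03 nB; apply: contrapT => nb; apply: nB; split => //=; rewrite in_itv.
have {b1}[q1 lb1 ub1] := good s (u + v n) ltac:(lra) b1.
have {b2}[q2 lb2 ub2] := good s (u + 1 + v n) ltac:(lra) b2.
have {b3}[q3 lb3 ub3] := good s' u ltac:(lra) b3.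
have {b4}[q4 lb4 ub4] := good s' (u + 1) ltac:(lra) b4.
have e1 : s' n + u = s n + (u + v n) by rewrite /s'; ring.
have e2 : s' n + (u + 1) = s n + (u + 1 + v n) by rewrite /s'; ring.
rewrite e1 in q3 lb3 ub3; rewrite e2 in q4 lb4 ub4.
have [_ Sn _ fails] := Hp n.
have [A0 be0 Cb] := HS0 _ Sn.
have [A'0 be'0 Cb'] := HS0 (s' n) (lt_le_trans Sn (ss' n)).
have b'b : beta (s' n) <= r * beta (s n).
  by rewrite /r mulrAC ler_pdivlMr// mulrC (le_trans lb3).
have bb' : beta (s n) <= r * beta (s' n).
  by rewrite /r mulrAC ler_pdivlMr// mulrC (le_trans lb1).
have [h1 h2] := increments_from_two_points A0 A'0 be0 be'0 C_gt0 u01 q1 q2 q3 q4 b'b Cb Cb'.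
apply: fails; rewrite -/(s n) -/(v n) -/(s' n).
have AB0 : 0 <= alpha (s n) * beta (s n) by rewrite mulr_ge0 // ltW.
have K1 : 3 * C * (1 + 2 * r) <= K by rewrite lerDl ltW.
have K2 : r <= K.
  by rewrite /K lerDr; apply: mulr_ge0; [apply: mulr_ge0 => //; exact: ltW|lra].
split.
- by apply: (le_trans h1); rewrite ler_wpM2r.
- by apply: (le_trans h2); rewrite ler_wpM2r.
- by apply: (le_trans b'b); rewrite ler_wpM2r // ltW.
- by apply: (le_trans bb'); rewrite ler_wpM2r // ltW.
Unshelve. all: by end_near.
Qed.

(** A negative shift is a positive one from the other end, where the scales
    alpha and beta are comparable. *)
Lemma uniform_increments : exists2 K : R, 0 < K & \forall s \near +oo,
  forall v, `|v| <= 1 ->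
  [/\ `|W (s + v) - W s - alpha s * v| <= K * (alpha s * beta s),
      `|alpha (s + v) - alpha s| <= K * (alpha s * beta s)
    & beta (s + v) <= K * beta s].
Proof.
have [K0 [S [_ HS]]] := uniform_increments_right.
pose K := Num.max K0 1.
have K1 : 1 <= K by rewrite le_max lexx orbT.
have Kge0 : 0 <= K by lra.
have HK s : S < s -> 0 < alpha s -> 0 < beta s -> forall v, 0 <= v <= 1 -> 0 < beta (s + v) ->
  [/\ `|W (s + v) - W s - alpha s * v| <= K * (alpha s * beta s),
      `|alpha (s + v) - alpha s| <= K * (alpha s * beta s),
      beta (s + v) <= K * beta s & beta s <= K * beta (s + v)].
  move=> Ss a0 b0 v v01 b0'; have [h1 h2 h3 h4] := HS s Ss v v01.
  have K0K : K0 <= K by rewrite le_max lexx.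
  have ab0 : 0 <= alpha s * beta s by rewrite mulr_ge0 // ltW.
  split; [apply: (le_trans h1)|apply: (le_trans h2)|apply: (le_trans h3)|apply: (le_trans h4)];
    by apply: ler_wpM2r => //; exact: ltW.
exists (4 * K ^+ 2); first by rewrite mulr_gt0 // exprn_gt0 //; lra.
have [S1 [_ HS1]] : \forall s \near +oo, [/\ 0 < alpha s, 0 < beta s & 2 * K * beta s <= 1].
  have e0 : 0 < (2 * K)^-1 by rewrite invr_gt0; lra.
  near=> s; split; [by near: s|by near: s|].
  have b0 : 0 < beta s by near: s.
  rewrite -ler_pdivlMl ?mulr1; last lra.
  rewrite -[leLHS]gtr0_norm//.
  by near: s; exact: cvgr0_norm_le.
exists (Num.max S S1 + 1); split; first exact: num_real.
move=> s; rewrite -ltrBrDr gt_max => /andP[sS sS1] v; rewrite ler_norml => /andP[v1 v2].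
have [a0 b0 kb] : [/\ 0 < alpha s, 0 < beta s & 2 * K * beta s <= 1] by apply: HS1; lra.
have [a0' b0' kb'] : [/\ 0 < alpha (s + v), 0 < beta (s + v) & 2 * K * beta (s + v) <= 1].
  by apply: HS1; lra.
have KK : K <= K ^+ 2 by rewrite expr2 ler_peMr.
have ab0 : 0 <= alpha s * beta s by rewrite mulr_ge0 // ltW.
have [v0|v0] := leP 0 v.
  have [h1 h2 h3 _] := HK s ltac:(lra) a0 b0 v ltac:(lra) b0'.
  split; [apply: (le_trans h1)|apply: (le_trans h2)|apply: (le_trans h3)];
    by apply: ler_wpM2r => //; lra.
have sE : s = s + v + - v by ring.
have := HK (s + v) ltac:(lra) a0' b0' (- v) ltac:(lra).
rewrite addrK => /(_ b0)[h1 h2 h3 h4].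
have KA : K * (alpha (s + v) * beta (s + v)) <= 2^-1 * alpha (s + v).
  have -> : K * (alpha (s + v) * beta (s + v)) = alpha (s + v) * (2 * K * beta (s + v)) / 2.
    by field.
  have := ler_wpM2l (ltW a0') kb'; rewrite mulr1; lra.
have aa : alpha (s + v) <= 2 * alpha s.
  by move: h2; rewrite ler_norml => /andP[h2 _]; lra.
have KA2 : K * (alpha (s + v) * beta (s + v)) <= 2 * K ^+ 2 * (alpha s * beta s).
  have -> : 2 * K ^+ 2 * (alpha s * beta s) = K * ((2 * alpha s) * (K * beta s)) by ring.
  by apply: ler_wpM2l => //; apply: ler_pM => //; exact: ltW.
have X0 : 0 <= K ^+ 2 * (alpha s * beta s) by rewrite mulr_ge0 // sqr_ge0.
split.
- move: h1 h2; rewrite !ler_norml => /andP[l1 r1] /andP[l2 r2].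
  have dv : - (K * (alpha (s + v) * beta (s + v))) <= (alpha (s + v) - alpha s) * v <= K * (alpha (s + v) * beta (s + v)).
    rewrite -ler_norml normrM; apply: (@le_trans _ _ (`|alpha (s + v) - alpha s| * 1)).
      by rewrite ler_wpM2l // ler_norml; apply/andP; split; lra.
    by rewrite mulr1 distrC ler_norml l2 r2.
  have dE : (alpha (s + v) - alpha s) * v = alpha (s + v) * v - alpha s * v by ring.
  rewrite dE mulrN in dv l1 r1; case/andP: dv => dv1 dv2.
  by apply/andP; split; lra.
- rewrite distrC; apply: (le_trans h2); lra.
- by apply: (le_trans h4); apply: ler_wpM2r; [exact: ltW|lra].
Unshelve. all: by end_near.
Qed.

End UniformIncrements.

(** * Increments over a long range *)

(** Each a j stays within a factor 2 of a 0 because the relative errors add up to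
    at most 1, so that all errors are at most multiples of tau * a 0. *)
Lemma slowly_varying_sum (R : realFieldType) (w a : nat -> R) (tau : R) (m : nat) :
  0 <= tau -> 2 * m%:R * tau <= 1 -> 0 < a 0%N ->
  (forall j, (j < m)%N -> `|a j.+1 - a j| <= tau * a j) ->
  (forall j, (j < m)%N -> `|w j.+1 - w j - a j| <= tau * a j) ->
  `|a m - a 0%N| <= 2 * m%:R * tau * a 0%N /\
  `|w m - w 0%N - a 0%N * m%:R| <= m%:R * (m%:R + 1) * tau * a 0%N.
Proof.
move=> tau0 + a0; elim: m => [|m IH] mtau Ha Hw.
  by rewrite !subrr !mulr0 !mul0r subr0 normr0.
have : 0 <= m%:R :> R by [].
have mm1 : m.+1%:R = m%:R + 1 :> R by rewrite natr1.
rewrite mm1 in mtau *; move: (m%:R : R) IH mtau {mm1} => M IH mtau M0.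
have mt0 : 0 <= M * tau by rewrite mulr_ge0.
have [] := IH _ (fun j jm => Ha j (ltnW jm)) (fun j jm => Hw j (ltnW jm)); first lra.
have at0 : 0 <= tau * a 0%N by rewrite mulr_ge0 // ltW.
have am : (2 * M * tau) * a 0%N <= 1 * a 0%N by apply: ler_wpM2r; [exact: ltW|lra].
move=> h1 h2; have := Ha m (ltnSn _); have := Hw m (ltnSn _).
have am2 : a m <= 2 * a 0%N by move: h1; rewrite ler_norml => /andP[_ ?]; lra.
have tam : tau * a m <= 2 * (tau * a 0%N).
  by rewrite mulrCA; apply: ler_wpM2l.
move: h1 h2; rewrite !ler_norml => /andP[l1 r1] /andP[l2 r2] /andP[l3 r3] /andP[l4 r4].
by split; apply/andP; split; lra.
Qed.

Section FarIncrement.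
Variable R : realType.
Variables (W alpha beta : R -> R) (K : R).
Hypothesis K_gt0 : 0 < K.
Hypothesis incr : \forall s \near +oo, forall v, `|v| <= 1 ->
  [/\ `|W (s + v) - W s - alpha s * v| <= K * (alpha s * beta s),
      `|alpha (s + v) - alpha s| <= K * (alpha s * beta s)
    & beta (s + v) <= K * beta s].
Hypothesis alpha_gt0 : \forall s \near +oo, 0 < alpha s.
Hypothesis beta_gt0 : \forall s \near +oo, 0 < beta s.
Hypothesis beta_growth : \forall s \near +oo, beta (s + 1) <= expR (4^-1) * beta s.

(** The range of length y is cut into unit steps and a remainder.  On it beta has
    grown by at most e^(y/4), and tau bounds the relative error of every step. *)
Lemma far_increment_bound : \forall s \near +oo, forall y tau, 0 <= y ->
  K * beta s * expR (y / 4) <= tau -> (y + 2) ^+ 2 * tau <= 1 ->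
  `|W (s + y) - W s - alpha s * y| <= (y + 2) ^+ 2 * tau * alpha s.
Proof.
have [S [_ HS]] : \forall s \near +oo, [/\ forall v, `|v| <= 1 ->
  [/\ `|W (s + v) - W s - alpha s * v| <= K * (alpha s * beta s),
      `|alpha (s + v) - alpha s| <= K * (alpha s * beta s)
    & beta (s + v) <= K * beta s],
   0 < alpha s, 0 < beta s & beta (s + 1) <= expR (4^-1) * beta s].
  near=> s; split; by near: s.
exists S; split; first exact: num_real.
move=> s Ss y tau y0 Ktau ytau.
have Sj j : S < s + j%:R by apply: (lt_le_trans Ss); rewrite lerDl.
have bj j : beta (s + j%:R) <= beta s * expR (j%:R / 4).
  elim: j => [|j IH]; first by rewrite addr0 mul0r expR0 mulr1.
  have [_ _ _] := HS _ (Sj j); rewrite -addrA natr1 => /le_trans; apply.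
  rewrite -[X in X / 4]natr1 mulrDl expRD mul1r mulrA mulrC ler_wpM2r ?expR_ge0 //.
pose m := Num.truncn y.
have [my ym] : m%:R <= y /\ y < m%:R + 1.
  by have /andP[] := truncn_itv y0; rewrite -[X in _ < X]natr1; split.
have kb j : (j <= m)%N -> K * beta (s + j%:R) <= tau.
  move=> jm; apply: le_trans Ktau; rewrite -mulrA ler_pM2l //.
  apply: (le_trans (bj j)); rewrite ler_wpM2l //; first by have [_ _ /ltW] := HS _ Ss.
  by rewrite ler_expR ler_wpM2r // (le_trans _ my) // ler_nat.
have tau0 : 0 <= tau.
  have [_ _ b0 _] := HS _ Ss.
  by apply: le_trans Ktau; rewrite !mulr_ge0 ?expR_ge0 // ltW.
have m0 : 0 <= m%:R :> R by [].
have mtau : (m%:R + 2) ^+ 2 * tau <= (y + 2) ^+ 2 * tau.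
  by rewrite ler_wpM2r // ler_sqr ?nnegrE; lra.
have m2 : 0 <= m%:R * m%:R :> R by rewrite mulr_ge0.
have mtau0 : 0 <= m%:R * tau by rewrite mulr_ge0.
have m2tau : 0 <= m%:R * m%:R * tau by rewrite mulr_ge0.
have sqE : (m%:R + 2) ^+ 2 * tau = m%:R * m%:R * tau + 4 * (m%:R * tau) + 4 * tau by ring.
have aj j : 0 < alpha (s + j%:R) by have [_ + _ _] := HS _ (Sj j).
have kab j : (j <= m)%N -> K * (alpha (s + j%:R) * beta (s + j%:R)) <= tau * alpha (s + j%:R).
  by move=> jm; rewrite mulrCA mulrC ler_wpM2r ?kb// ltW.
have sS j : s + j.+1%:R = s + j%:R + 1 by rewrite -natr1 addrA.
have [||j jm|j jm|] := @slowly_varying_sum R (fun j => W (s + j%:R)) (fun j => alpha (s + j%:R)) tau m tau0.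
- lra.
- exact: aj.
- have [/(_ 1) ] := HS _ (Sj j); rewrite normr1 lexx => /(_ isT)[_ h _] _ _ _.
  by rewrite sS; apply: (le_trans h); apply: kab; exact: ltnW.
- have [/(_ 1) ] := HS _ (Sj j); rewrite normr1 lexx mulr1 => /(_ isT)[h _ _] _ _ _.
  by rewrite sS; apply: (le_trans h); apply: kab; exact: ltnW.
rewrite addr0 => h1 h2.
pose r := y - m%:R.
have r01 : 0 <= r <= 1 by rewrite /r; apply/andP; split; lra.
case/andP: (r01) => r0 r1.
have [/(_ r) + _ _ _] := HS _ (Sj m); rewrite ger0_norm // => /(_ r1)[h3 _ _].
have := le_trans h3 (kab m (leqnn m)).
have -> : s + m%:R + r = s + y by rewrite /r; ring.
have a0 : 0 < alpha s by have [_ + _ _] := HS _ Ss.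
have am2 : alpha (s + m%:R) <= 2 * alpha s.
  have : 2 * m%:R * tau * alpha s <= 1 * alpha s by apply: ler_wpM2r; [exact: ltW|lra].
  by move: h1; rewrite ler_norml => /andP[_ ?]; lra.
have tam : tau * alpha (s + m%:R) <= 2 * tau * alpha s.
  by rewrite mulrAC [leRHS]mulrC; apply: ler_wpM2l.
have : `|(alpha (s + m%:R) - alpha s) * r| <= 2 * m%:R * tau * alpha s.
  rewrite normrM -[leRHS]mulr1; apply: ler_pM => //.
  by rewrite ger0_norm.
rewrite mulrBl.
have -> : alpha s * r = alpha s * y - alpha s * m%:R by rewrite /r; ring.
have -> : (y + 2) ^+ 2 * tau * alpha s = (y + 2) ^+ 2 * tau * alpha s - (m%:R + 2) ^+ 2 * tau * alpha s + (m%:R + 2) ^+ 2 * tau * alpha s by ring.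
have h4 : (m%:R + 2) ^+ 2 * tau * alpha s <= (y + 2) ^+ 2 * tau * alpha s.
  by rewrite ler_wpM2r // ltW.
have ta0 : 0 <= tau * alpha s by rewrite mulr_ge0 // ltW.
have mta0 : 0 <= m%:R * tau * alpha s by rewrite mulr_ge0 // ltW.
have sqE' : (m%:R + 2) ^+ 2 * tau * alpha s = m%:R * m%:R * tau * alpha s + 4 * (m%:R * tau * alpha s) + 4 * (tau * alpha s) by ring.
move: h2; rewrite !ler_norml => /andP[l1 r2] /andP[l2 r3] /andP[l3 r4].
by apply/andP; split; lra.
Unshelve. all: by end_near.
Qed.

(** With beta (s n) of order e^(-L/2), the worst relative error on a range of
    length L + x is of order e^(-L/4), which beats the quadratic factor of
    far_increment_bound. *)
Lemma far_increment (s L : nat -> R) (B x e : R) :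
  s n @[n --> \oo] --> +oo -> L n @[n --> \oo] --> +oo ->
  (\forall n \near \oo, beta (s n) * expR (L n / 2) <= B) -> 0 < e ->
  \forall n \near \oo,
    `|W (s n + (L n + x)) - W (s n) - alpha (s n) * (L n + x)| <= e * alpha (s n).
Proof.
move=> s_y L_y HB e0.
pose e1 := Num.min e 1.
have e10 : 0 < e1 by rewrite lt_min e0 ltr01.
pose B1 := Num.max B 1.
have B10 : 0 < B1 by rewrite lt_max ltr01 orbT.
pose G := K * B1 * expR (x / 4).
have G0 : 0 < G by rewrite !mulr_gt0 ?expR_gt0.
near=> n.
have y0 : 0 <= L n + x.
  rewrite -lerBlDr sub0r; near: n; exact: (cvgryPge (L : nat -> R)).1.
have L2 : `|x| + 2 <= L n by near: n; exact: (cvgryPge (L : nat -> R)).1.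
have LG : 1536 * G / e1 <= L n by near: n; exact: (cvgryPge (L : nat -> R)).1.
have L0 : 0 < L n by apply: lt_le_trans L2; rewrite ltr_wpDl.
pose tau := G * expR (- (L n / 4)).
have tau0 : 0 <= tau by rewrite mulr_ge0 ?expR_ge0 // ltW.
have h1 : K * beta (s n) * expR ((L n + x) / 4) <= tau.
  have -> : tau = K * (B1 * expR (- (L n / 2))) * expR ((L n + x) / 4).
    rewrite /tau /G; have -> : (L n + x) / 4 = x / 4 + (L n / 2 - L n / 4) by field.
    rewrite !expRD !expRN; field.
    by rewrite !gt_eqF ?expR_gt0.
  rewrite ler_wpM2r ?expR_ge0 // ler_pM2l // expRN ler_pdivlMr ?expR_gt0 //.
  apply: (@le_trans _ _ B); first by near: n.
  by rewrite le_max lexx.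
have h2 : (L n + x + 2) ^+ 2 * tau <= e1.
  apply: (@le_trans _ _ ((2 * L n) ^+ 2 * tau)).
    rewrite ler_wpM2r // ler_sqr ?nnegrE; [|lra|lra].
    have := ler_norm x; lra.
  have ez : expR (- (L n / 4)) <= 384 / L n ^+ 3.
    have z0 : 0 < (L n / 4) ^+ 3 / 6 by rewrite divr_gt0 // exprn_gt0 // divr_gt0.
    have -> : 384 / L n ^+ 3 = ((L n / 4) ^+ 3 / 6)^-1 by field; rewrite gt_eqF.
    rewrite expRN lef_pV2 ?posrE ?expR_gt0 //.
    have l4 : 0 <= L n / 4 by rewrite divr_ge0 // ltW.
    have := expR_ge1Dxn 2 l4.
    have -> : (3`!)%:R = 6 :> R by [].
    by apply: le_trans; rewrite lerDr.
  apply: (@le_trans _ _ ((2 * L n) ^+ 2 * (G * (384 / L n ^+ 3)))).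
    by rewrite ler_wpM2l ?sqr_ge0 // ler_wpM2l // ltW.
  have -> : (2 * L n) ^+ 2 * (G * (384 / L n ^+ 3)) = 1536 * G / L n by field; rewrite gt_eqF.
  by rewrite ler_pdivrMr // [leRHS]mulrC -ler_pdivrMr.
have ha : 0 < alpha (s n) by near: n; exact: (s_y _ alpha_gt0).
apply: (@le_trans _ _ ((L n + x + 2) ^+ 2 * tau * alpha (s n))).
  have h3 : (L n + x + 2) ^+ 2 * tau <= 1 by apply: (le_trans h2); rewrite ge_min lexx orbT.
  have bound : forall y t, 0 <= y -> K * beta (s n) * expR (y / 4) <= t ->
      (y + 2) ^+ 2 * t <= 1 ->
      `|W (s n + y) - W (s n) - alpha (s n) * y| <= (y + 2) ^+ 2 * t * alpha (s n).
    by near: n; exact: (s_y _ far_increment_bound).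
  exact: bound.
by rewrite ler_wpM2r ?(ltW ha) // (le_trans h2) // ge_min lexx.
Unshelve. all: by end_near.
Qed.

End FarIncrement.

Section FirstOrderIncrements.
Variable R : realType.
Variables (W a : R -> R) (gamma : R).
Hypothesis gamma_neq0 : gamma != 0.
Hypothesis W_nd : {in `]0, +oo[ &, {homo W : s t / s <= t}}.
Hypothesis a_gt0 : \forall s \near +oo, 0 < a s.

Let h (u : R) := (expR (gamma * u) - 1) / gamma.

Hypothesis W_first : forall u, (W (s + u) - W s) / a s @[s --> +oo] --> h u.

(** Every first-order comparison of increments needed below is the sign of such a
    limit. *)
Lemma first_order_combination c1 u1 c2 u2 c3 u3 :
  0 < c1 * h u1 + c2 * h u2 + c3 * h u3 ->
  \forall s \near +oo,
    0 < c1 * (W (s + u1) - W s) + c2 * (W (s + u2) - W s) + c3 * (W (s + u3) - W s).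
Proof.
move=> h0.
have cv : c1 * ((W (s + u1) - W s) / a s) + c2 * ((W (s + u2) - W s) / a s) +
  c3 * ((W (s + u3) - W s) / a s) @[s --> +oo] --> c1 * h u1 + c2 * h u2 + c3 * h u3.
  by apply: cvgD; [apply: cvgD|]; apply: cvgMr; exact: W_first.
near=> s.
have as0 : 0 < a s by near: s.
have : 0 < c1 * ((W (s + u1) - W s) / a s) + c2 * ((W (s + u2) - W s) / a s) +
  c3 * ((W (s + u3) - W s) / a s) by near: s; exact: (cvgr_gt _ cv).
rewrite !mulrA -!mulrDl pmulr_lgt0 ?invr_gt0 //.
Unshelve. all: by end_near.
Qed.

Lemma box_cox_exp_lt u1 u2 : u1 < u2 -> h u1 < h u2.
Proof.
move=> u12; rewrite /h; case: (ltgtP gamma 0) gamma_neq0 => // g0 _.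
  by rewrite ltr_nM2r ?invr_lt0 // ltrD2r ltr_expR ltr_nM2l.
by rewrite ltr_pM2r ?invr_gt0 // ltrD2r ltr_expR ltr_pM2l.
Qed.

Let h0 : h 0 = 0. Proof. by rewrite /h mulr0 expR0 subrr mul0r. Qed.

Lemma first_order_increasing u1 u2 : u1 < u2 ->
  \forall s \near +oo, W (s + u1) < W (s + u2).
Proof.
move=> u12.
have := @first_order_combination 1 u2 (-1) u1 0 0.
rewrite mul0r addr0 mul1r mulN1r subr_gt0 => /(_ (box_cox_exp_lt u12)).
by apply: filterS => s; lra.
Qed.

Lemma geometric_increments_ge (w : nat -> R) (q : R) : 0 <= q ->
  (forall j, q * (w j.+1 - w j) <= w j.+2 - w j.+1) ->
  forall m, q ^+ m * (w 1%N - w 0%N) <= w m.+1 - w m.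
Proof.
move=> q0 Hw; elim=> [|m IH]; first by rewrite expr0 mul1r.
by rewrite exprS -mulrA (le_trans _ (Hw m)) // ler_wpM2l.
Qed.

Lemma geometric_increments_le (w : nat -> R) (q : R) : 0 <= q < 1 -> 0 <= w 1%N - w 0%N ->
  (forall j, w j.+2 - w j.+1 <= q * (w j.+1 - w j)) ->
  forall m, w m - w 0%N <= (w 1%N - w 0%N) / (1 - q).
Proof.
move=> /andP[q0 q1] d0 Hw m.
have Hd j : w j.+1 - w j <= q ^+ j * (w 1%N - w 0%N).
  elim: j => [|j IH]; first by rewrite expr0 mul1r.
  by rewrite exprS -mulrA (le_trans (Hw j)) // ler_wpM2l.
have Hs : w m - w 0%N <= (1 - q ^+ m) * ((w 1%N - w 0%N) / (1 - q)).
  elim: m => [|m IH]; first by rewrite expr0 !subrr mul0r.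
  have -> : w m.+1 - w 0%N = (w m.+1 - w m) + (w m - w 0%N) by ring.
  apply: (le_trans (lerD (Hd m) IH)).
  rewrite le_eqVlt exprS; apply/orP; left; apply/eqP; field.
  by rewrite subr_eq0 gt_eqF.
apply: (le_trans Hs); rewrite -[leRHS]mul1r ler_wpM2r //.
  by rewrite divr_ge0 // subr_ge0 ltW.
by rewrite gerBl exprn_ge0.
Qed.

(** For gamma > 0 the unit increments grow at least by the factor e^(gamma/2), so
    the last one alone exceeds any multiple of L n times the first ones. *)
Lemma far_increment_large (s L : nat -> R) (x K : R) : 0 < gamma ->
  s n @[n --> \oo] --> +oo -> L n @[n --> \oo] --> +oo ->
  \forall n \near \oo,
    K * L n * (W (s n + 1) - W (s n - 1)) <= W (s n + (L n + x)) - W (s n + 1).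
Proof.
move=> g0 s_y L_y.
pose q := expR (gamma / 2).
have q0 : 0 < q by exact: expR_gt0.
have E2 : expR gamma = q ^+ 2 by rewrite /q -expRM_natl; congr expR; field.
have q1 : 1 < q by rewrite /q expR_gt1 divr_gt0.
have h1 : h 1 = (q ^+ 2 - 1) / gamma by rewrite /h mulr1 E2.
have h2 : h 2 = (q ^+ 4 - 1) / gamma.
  by rewrite /h [gamma * 2]mulrC expRM_natl E2 -exprM.
have hN1 : h (- 1) = (q ^- 2 - 1) / gamma by rewrite /h mulrN1 expRN E2.
have f1 : \forall t \near +oo, q * (W (t + 1) - W t) < W (t + 2) - W (t + 1).
  have := @first_order_combination 1 2 (- (1 + q)) 1 0 0.
  rewrite mul0r addr0 h1 h2.
  have -> : 1 * ((q ^+ 4 - 1) / gamma) + - (1 + q) * ((q ^+ 2 - 1) / gamma) =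
    q * (q - 1) * (q ^+ 2 - 1) / gamma by field; rewrite gt_eqF.
  have q21 : 0 < q ^+ 2 - 1 by rewrite subr_gt0 expr_gt1 // ltW.
  move=> /(_ ltac:(by rewrite divr_gt0 // !mulr_gt0 // subr_gt0)).
  by apply: filterS => t; lra.
have f2 : \forall t \near +oo, 0 < W (t + 1) - W t.
  have := first_order_increasing (@ltr01 R).
  by apply: filterS => t; rewrite addr0 subr_gt0.
have f3 : \forall t \near +oo, W t - W (t - 1) < W (t + 1) - W t.
  have := @first_order_combination 1 1 1 (-1) 0 0.
  rewrite mul0r addr0 h1 hN1.
  have -> : 1 * ((q ^+ 2 - 1) / gamma) + 1 * ((q ^- 2 - 1) / gamma) =
    (q ^+ 2 - 1) ^+ 2 / q ^+ 2 / gamma by field; rewrite !gt_eqF.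
  have q21 : 0 < q ^+ 2 - 1 by rewrite subr_gt0 expr_gt1 // ltW.
  move=> /(_ ltac:(by rewrite !divr_gt0 // exprn_gt0)).
  by apply: filterS => t; lra.
have [S [_ HS]] : \forall t \near +oo, [/\ q * (W (t + 1) - W t) < W (t + 2) - W (t + 1),
    0 < W (t + 1) - W t, W t - W (t - 1) < W (t + 1) - W t & 0 < t].
  near=> t; split; [by near: t..|near: t; exact: nbhs_pinfty_gt].
pose K1 := Num.max K 1.
have K10 : 0 < K1 by rewrite lt_max ltr01 orbT.
near=> n.
have sS : S < s n by near: n; exact: (cvgryPgt s).1.
have [_ d0 dd s0] := HS _ sS.
have L0 : 2 + `|x| <= L n by near: n; exact: (cvgryPge L).1.
have Ln0 : 0 <= L n by have := normr_ge0 x; lra.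
have xn := ler_norm (- x); rewrite normrN in xn.
have y2 : 2 <= L n + x by lra.
pose m := Num.truncn (L n + x).
have [my ym] : m%:R <= L n + x /\ L n + x < m%:R + 1.
  have y0 : 0 <= L n + x by lra.
  by have /andP[] := truncn_itv y0; rewrite -[X in _ < X]natr1; split.
have m2 : (2 <= m)%N by rewrite truncn_ge_nat //; lra.
have [p mp] : exists p, m = p.+1 by exists m.-1; rewrite prednK // (leq_trans _ m2).
have sN (j : nat) : s n + j.+1%:R = s n + j%:R + 1 by rewrite -[in LHS]natr1 addrA.
have sN2 (j : nat) : s n + j.+2%:R = s n + j%:R + 2 by rewrite sN sN; ring.
have hp : q ^+ p * (W (s n + 1) - W (s n + 0)) <= W (s n + p.+1%:R) - W (s n + p%:R).
  apply: (geometric_increments_ge (w := fun j => W (s n + j%:R)) (ltW q0)) => j.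
  have [|+ _ _ _] := HS (s n + j%:R); first by rewrite (lt_le_trans sS) // lerDl.
  by rewrite sN sN2 => /ltW.
rewrite addr0 in hp.
have p1 : W (s n + 1) <= W (s n + p%:R).
  apply: W_nd; rewrite ?in_itv /= ?andbT ?ltr_wpDr // lerD2l ler1n.
  by rewrite -ltnS -mp.
have mW : W (s n + m%:R) <= W (s n + (L n + x)).
  by apply: W_nd; rewrite ?in_itv /= ?andbT ?ltr_wpDr ?lerD2l //; lra.
rewrite -mp in hp.
have qp : 2 * K1 * L n <= q ^+ p.
  have -> : q ^+ p = expR (p%:R * (gamma / 2)) by rewrite expRM_natl.
  have pL : L n / 2 - (2 - x) <= p%:R - L n / 2.
    have : m%:R = p%:R + 1 :> R by rewrite mp -natr1.
    by move=> ?; lra.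
  have L1 : 2 * (2 - x) <= L n by near: n; exact: (cvgryPge L).1.
  have pL2 : L n * (gamma / 4) <= p%:R * (gamma / 2).
    have -> : L n * (gamma / 4) = L n / 2 * (gamma / 2) by field.
    by rewrite ler_wpM2r // ?divr_ge0 ?(ltW g0) //; lra.
  apply: (@le_trans _ _ (expR (L n * (gamma / 4)))); last by rewrite ler_expR.
  have z0 : 0 <= L n * (gamma / 4) by rewrite mulr_ge0 // divr_ge0 // ltW.
  have := expR_ge1Dxn 1 z0.
  have -> : (2`!)%:R = 2 :> R by [].
  apply: le_trans.
  have L3 : 64 * K1 / gamma ^+ 2 <= L n by near: n; exact: (cvgryPge L).1.
  have : 64 * K1 / gamma ^+ 2 * (L n * gamma ^+ 2 / 32) <= L n * (L n * gamma ^+ 2 / 32).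
    by apply: ler_wpM2r => //; rewrite divr_ge0 // mulr_ge0 ?sqr_ge0.
  have -> : 64 * K1 / gamma ^+ 2 * (L n * gamma ^+ 2 / 32) = 2 * K1 * L n by field; rewrite gt_eqF.
  have -> : (L n * (gamma / 4)) ^+ 2 / 2 = L n * (L n * gamma ^+ 2 / 32) by field.
  by move=> /le_trans; apply; rewrite lerDr.
have KL : K * L n * (W (s n + 1) - W (s n - 1)) <= K1 * L n * (2 * (W (s n + 1) - W (s n))).
  apply: (@le_trans _ _ (K1 * L n * (W (s n + 1) - W (s n - 1)))).
    apply: ler_wpM2r; last by apply: ler_wpM2r => //; rewrite le_max lexx.
    rewrite subr_ge0; apply: W_nd; rewrite ?in_itv /= ?andbT; [|lra|lra].
    by have : 1 < s n by [near: n; exact: (cvgryPgt s).1]; lra.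
  by apply: ler_wpM2l; [rewrite mulr_ge0 // ltW|lra].
have : 2 * K1 * L n * (W (s n + 1) - W (s n)) <= q ^+ p * (W (s n + 1) - W (s n)).
  by rewrite ler_wpM2r // ltW.
have E : K1 * L n * (2 * (W (s n + 1) - W (s n))) = 2 * K1 * L n * (W (s n + 1) - W (s n)) by ring.
rewrite E in KL => hq; apply: (le_trans KL); apply: (le_trans hq); apply: (le_trans hp).
lra.
Unshelve. all: by end_near.
Qed.

(** For gamma < 0 the unit increments decay at least by the factor e^(gamma/2), so
    their sum is a bounded multiple of the first one. *)
Lemma far_increment_small (v1 v2 : R) : gamma < 0 -> v1 < v2 -> exists K : R,
  forall (s L : nat -> R) x,
  s n @[n --> \oo] --> +oo -> L n @[n --> \oo] --> +oo ->
  \forall n \near \oo,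
    W (s n + (L n + x)) - W (s n - v1) <= K * (W (s n - v1) - W (s n - v2)).
Proof.
move=> g0 v12.
pose q := expR (gamma / 2).
have q0 : 0 < q by exact: expR_gt0.
have E2 : expR gamma = q ^+ 2 by rewrite /q -expRM_natl; congr expR; field.
have q1 : q < 1 by rewrite /q expR_lt1 nmulr_rlt0.
have h1 : h 1 = (q ^+ 2 - 1) / gamma by rewrite /h mulr1 E2.
have h2 : h 2 = (q ^+ 4 - 1) / gamma.
  by rewrite /h [gamma * 2]mulrC expRM_natl E2 -exprM.
have f1 : \forall t \near +oo, W (t + 2) - W (t + 1) < q * (W (t + 1) - W t).
  have := @first_order_combination (-1) 2 (1 + q) 1 0 0.
  rewrite mul0r addr0 h1 h2.
  have -> : -1 * ((q ^+ 4 - 1) / gamma) + (1 + q) * ((q ^+ 2 - 1) / gamma) =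
    q * (1 - q) * (1 - q ^+ 2) / (- gamma) by field; rewrite lt_eqF.
  have q21 : 0 < 1 - q ^+ 2 by rewrite subr_gt0 expr_lt1 // ltW.
  move=> /(_ ltac:(by rewrite divr_gt0 ?oppr_gt0 // !mulr_gt0 // subr_gt0)).
  by apply: filterS => t; lra.
have f2 : \forall t \near +oo, 0 < W (t + 1) - W t.
  have := first_order_increasing (@ltr01 R).
  by apply: filterS => t; rewrite addr0 subr_gt0.
have hv : 0 < h (- v1) - h (- v2) by rewrite subr_gt0 box_cox_exp_lt // ltrN2.
(* K exceeds the limit of the quotient of the two sides, each in units of a. *)
pose K := (h 1 / (1 - q) - h (- v1) + 1) / (h (- v1) - h (- v2)).
exists K => s L x s_y L_y.
have f3 : \forall t \near +oo, W t - W (t - v1) + (W (t + 1) - W t) / (1 - q) <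
    K * (W (t - v1) - W (t - v2)).
  have := @first_order_combination (K + 1) (- v1) (- K) (- v2) (- (1 - q)^-1) 1.
  have -> : (K + 1) * h (- v1) + - K * h (- v2) + - (1 - q)^-1 * h 1 =
     K * (h (- v1) - h (- v2)) + h (- v1) - h 1 / (1 - q) by ring.
  rewrite /K divfK ?gt_eqF // => /(_ ltac:(lra)).
  by apply: filterS => t; rewrite -/K [(W (t + 1) - W t) / _]mulrC; lra.
have [S [_ HS]] : \forall t \near +oo, [/\ W (t + 2) - W (t + 1) < q * (W (t + 1) - W t),
    0 < W (t + 1) - W t, W t - W (t - v1) + (W (t + 1) - W t) / (1 - q) <
    K * (W (t - v1) - W (t - v2)) & 0 < t].
  near=> t; split; [by near: t..|near: t; exact: nbhs_pinfty_gt].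
near=> n.
have sS : S < s n by near: n; exact: (cvgryPgt s).1.
have [_ d0 dd s0] := HS _ sS.
have L0 : - x <= L n by near: n; exact: (cvgryPge L).1.
have y0 : 0 <= L n + x by lra.
pose m := (Num.truncn (L n + x)).+1.
have ym : L n + x <= m%:R by have /andP[_ /ltW] := truncn_itv y0.
have sN (j : nat) : s n + j.+1%:R = s n + j%:R + 1 by rewrite -[in LHS]natr1 addrA.
have sN2 (j : nat) : s n + j.+2%:R = s n + j%:R + 2 by rewrite sN sN; ring.
have hm : W (s n + m%:R) - W (s n + 0) <= (W (s n + 1) - W (s n + 0)) / (1 - q).
  apply: (geometric_increments_le (w := fun j => W (s n + j%:R))) => [||j].
  - by rewrite q1 ltW.
  - by rewrite addr0 ltW.
  - have [|+ _ _ _] := HS (s n + j%:R); first by rewrite (lt_le_trans sS) // lerDl.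
    by rewrite sN2 sN => /ltW.
rewrite addr0 in hm.
have mW : W (s n + (L n + x)) <= W (s n + m%:R).
  by apply: W_nd; rewrite ?in_itv /= ?andbT ?ltr_wpDr ?lerD2l.
lra.
Unshelve. all: by end_near.
Qed.

End FirstOrderIncrements.

(** * The second-order condition on the logarithmic scale *)

Section LogScale.
Variable R : realType.

Lemma expR_cvgy : @expR R x @[x --> +oo] --> +oo.
Proof.
apply/cvgryPge => M; near=> x; apply: le_trans (expR_ge1Dx x).
have : M <= x by near: x; exact: nbhs_pinfty_ge (num_real M).
lra.
Unshelve. all: by end_near.
Qed.

Lemma near_expR (Q : R -> Prop) : (\forall t \near +oo, Q t) -> \forall x \near +oo, Q (expR x).
Proof. exact: expR_cvgy. Qed.

Lemma cvg_expR (f : R -> R) (l : R) : f t @[t --> +oo] --> l -> f (expR x) @[x --> +oo] --> l.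
Proof. move=> fl; exact: (cvg_comp _ _ expR_cvgy fl). Qed.

Lemma box_cox_expR (gamma u : R) : gamma != 0 -> box_cox gamma (expR u) = (expR (gamma * u) - 1) / gamma.
Proof.
move=> g0; rewrite /box_cox (negbTE g0); congr ((_ - 1) / _).
by rewrite /powR gt_eqF ?expR_gt0 // expRK.
Qed.

Variables (U a A0 : R -> R) (rho : R).
Hypothesis rho_le0 : rho <= 0.
Hypothesis a_gt0 : forall t, 1 < t -> 0 < a t.
Hypothesis SO : second_order U 0 rho a A0.

Let W (x : R) : R := U (expR x).
Let alpha (x : R) : R := scale0 0 rho a A0 (expR x).
Let beta (x : R) : R := `|A0 (expR x)|.

Lemma beta_cvg0 : beta x @[x --> +oo] --> (0 : R).
Proof.
have [_ A00 _ _] := SO; apply: (cvg_expR (f := fun t => `|A0 t|)).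
by rewrite -(@normr0 _ R); exact: cvg_norm.
Qed.

Lemma beta_gt0 : \forall x \near +oo, 0 < beta x.
Proof. by have [_ _ [_ /near_expR]] := SO. Qed.

Lemma measurable_beta : measurable_fun (`]0, +oo[ : set R) beta.
Proof.
have [_ _ [mA _ _] _] := SO.
change (measurable_fun (`]0, +oo[ : set R) ((fun t => `|A0 t|) \o expR)).
apply: (@measurable_comp _ _ _ _ _ _ (`]1, +oo[%classic : set R)) => //.
  by move=> _ [x + <-]; rewrite /= !in_itv /= !andbT expR_gt1.
by apply: measurable_funTS.
Qed.

Lemma alpha_gt0 : \forall x \near +oo, 0 < alpha x.
Proof.
apply: (near_expR (Q := fun t => 0 < scale0 0 rho a A0 t)); have [_ A00 _ _] := SO; near=> t.
have at0 : 0 < a t by apply: a_gt0; near: t; exact: nbhs_pinfty_gt.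
have A1 : `|A0 t| < 1 by near: t; exact: (cvgr0_norm_lt _ A00).
rewrite /scale0 eqxx /=; case: ifP => // _.
by rewrite mulr_gt0 // subr_gt0 (le_lt_trans (ler_norm _)).
Unshelve. all: by end_near.
Qed.

Lemma beta_ratio u : beta (x + u) / beta x @[x --> +oo] --> expR (rho * u).
Proof.
have [_ _ [_ _ /(_ _ (expR_gt0 u)) /cvg_expR h] _] := SO.
rewrite /powR gt_eqF ?expR_gt0 // expRK in h.
by under eq_fun do rewrite /beta expRD.
Qed.

Lemma beta_growth : \forall x \near +oo, beta (x + 1) <= expR (4^-1) * beta x.
Proof.
near=> x; have b0 : 0 < beta x by near: x; exact: beta_gt0.
rewrite -ler_pdivrMr //; near: x.
apply: (cvgr_le _ (beta_ratio (u := 1))); rewrite mulr1 ltr_expR.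
by apply: (le_lt_trans rho_le0).
Unshelve. all: by end_near.
Qed.

Lemma Psi_star0_bound u : 0 <= u <= 3 -> `|Psi_star 0 rho (expR u)| < 5.
Proof.
move=> /andP[u0 u3]; rewrite /Psi_star eqxx /=; case: ifP => [r0|_].
  rewrite add0r box_cox_expR ?lt_eqF //.
  have h1 : 0 <= (expR (rho * u) - 1) / rho.
    rewrite mulr_le0 ?invr_le0 ?(ltW r0) // subr_le0 expR_le1.
    by rewrite nmulr_rle0.
  rewrite ger0_norm // ltr_ndivrMr //.
  have := expR_ge1Dx (rho * u).
  have : rho * 3 <= rho * u by rewrite ler_nM2l.
  lra.
rewrite expRK ger0_norm; last by rewrite mulr_ge0 ?sqr_ge0.
have : u ^+ 2 <= 3 ^+ 2 by rewrite ler_sqr ?nnegrE.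
lra.
Qed.

(** The limit Psi_star is smaller than 5 in absolute value for 0 <= u <= 3, and
    the regular variation of |A0| compares beta (x + u) with beta x. *)
Lemma second_order_step u : 0 <= u <= 3 ->
  \forall x \near +oo, bounded_step W alpha beta (expR (3 * rho) / 2) 5 x u.
Proof.
move=> u03; have [_ _ _ /(_ _ (expR_gt0 u)) /cvg_expR h] := SO.
have [u0 u3] := andP u03.
near=> x.
have b0 : 0 < beta x by near: x; exact: beta_gt0.
have a0 : 0 < alpha x by near: x; exact: alpha_gt0.
split.
- have : `|((U (expR x * expR u) - U (expR x)) / scale0 0 rho a A0 (expR x) -
    box_cox 0 (expR u)) / A0 (expR x)| < 5.
    near: x; apply: (cvgr_norm_lt _ h); exact: Psi_star0_bound.
  rewrite -expRD -/(W _) -/(W _) -/(alpha _) /box_cox eqxx expRK normrM normfV -/(beta x).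
  rewrite ltr_pdivrMr // => /ltW h5; rewrite -(ler_pM2l a0) in h5.
  rewrite mulrCA.
  apply: le_trans h5; rewrite -{2}(gtr0_norm a0) -normrM le_eqVlt; apply/orP; left.
  apply/eqP; congr `|_|; field; by rewrite gt_eqF.
- rewrite -ler_pdivlMr //; near: x; apply: (cvgr_ge _ (beta_ratio (u := u))).
  apply: (@lt_le_trans _ _ (expR (3 * rho))); first by have := expR_gt0 (3 * rho); lra.
  by rewrite ler_expR mulrC ler_wnM2l.
- rewrite -ler_pdivrMr //; near: x; apply: (cvgr_le _ (beta_ratio (u := u))).
  apply: (@le_lt_trans _ _ 1); last lra.
  by rewrite expR_le1 mulr_le0_ge0.
Unshelve. all: by end_near.
Qed.

End LogScale.

(** * Bounds on ratios, and the weights of the endpoint statistic *)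

Section Constants.
Variable R : realType.

Lemma ln2_lt1 : ln 2 < 1 :> R.
Proof.
rewrite -ltr_expR lnK ?posrE //.
by apply: le_lt_trans (expR_gt1Dx (oner_neq0 _)); lra.
Qed.

Lemma ln2_ge_half : 2^-1 <= ln 2 :> R.
Proof.
rewrite -ler_expR lnK ?posrE //.
have := expR_ge1Dx (- 2^-1 : R); rewrite expRN => h.
rewrite -[leLHS]invrK invf_ple ?posrE ?invr_gt0 ?expR_gt0 //; lra.
Qed.

Lemma gumbel_small (e : R) : 0 < e -> exists x, gumbel_cdf x <= e.
Proof.
move=> e0; exists (- e^-1); rewrite /gumbel_cdf opprK expRN.
rewrite invf_ple ?posrE ?expR_gt0 //.
have := expR_ge1Dx (expR e^-1); have := expR_ge1Dx e^-1; lra.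
Qed.

Lemma gumbel_large (e : R) : 0 < e -> exists x, 1 - e <= gumbel_cdf x.
Proof.
move=> e0; exists (- ln e); rewrite /gumbel_cdf opprK lnK ?posrE //.
exact: expR_ge1Dx.
Qed.

End Constants.

Lemma approx_of_bounds (R : realFieldType) (lo hi z w0 a v t e1 : R) :
  lo <= z <= hi -> `|lo - w0 - a * (v - t)| <= e1 -> `|hi - w0 - a * (v + t)| <= e1 ->
  `|z - (w0 + a * v)| <= a * t + e1.
Proof.
move=> /andP[h1 h2]; rewrite ler_norml => /andP[h3 h4]; rewrite ler_norml => /andP[h5 h6].
by rewrite ler_norml; apply/andP; split; lra.
Qed.

Lemma small_shift (R : realFieldType) (l v t : R) :
  2^-1 <= l -> - l <= v <= 0 -> 0 < t -> t <= 1 - l -> `|v - t| <= 1 /\ `|v + t| <= 1.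
Proof.
move=> lh /andP[v1 v2] t0 tl.
by split; rewrite ler_norml; apply/andP; split; lra.
Qed.

Lemma approx_sub (R : realFieldType) (A B w0 a u v e1 e2 : R) :
  `|A - (w0 + a * u)| <= e1 -> `|B - (w0 + a * v)| <= e2 ->
  `|A - B - a * (u - v)| <= e1 + e2.
Proof.
rewrite ler_norml => /andP[h1 h2]; rewrite ler_norml => /andP[h3 h4].
by rewrite ler_norml; apply/andP; split; lra.
Qed.

Lemma far_increment_recentered (R : realFieldType) (A w0 wf a e eps L x t : R) : 0 < a -> eps <= e ->
  `|A - (w0 + a * 0)| <= eps * a ->
  `|wf - w0 - a * (L + (x + t))| <= e * a ->
  a * (L + x + t - 2 * e) <= wf - A <= a * (L + x + t + 2 * e).
Proof.
move=> a0 epse; rewrite ler_norml => /andP[h1 h2]; rewrite ler_norml => /andP[h3 h4].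
have : eps * a <= e * a by rewrite ler_pM2r.
by move=> ?; apply/andP; split; lra.
Qed.

Lemma lower_spread_error (R : realFieldType) (e a u v : R) : 0 < e -> 0 < a ->
  u <= a * e -> v <= e * a -> v + (a * (2 * (e / 4)) + v) + u <= 4 * e * a.
Proof. by move=> e0 a0; have := mulr_gt0 e0 a0; lra. Qed.

Section LargeAndSmallRatios.
Variable R : realFieldType.

(** In this lemma and the next, l is ln 2, M the maximum, A and B the order
    statistics of ranks n - k and n - 2k, S the spread below A, and w1, wm, wf
    values of the tail quantile function at deterministic points. *)
Lemma ratio_large (l L M0 A B M S w1 wm wf : R) :
  2^-1 <= l -> l <= 1 -> `|M0| + 1 < L -> 0 < A - B -> 0 <= S ->
  4 * L * (w1 - wm) <= wf - w1 -> A <= w1 -> wm <= B -> wf <= M ->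
  M0 < (l * (M - A) + S) / (A - B) - (L + l / 2).
Proof.
move=> l0 l1 Ln D0 S0 far h1 h2 h3.
have L0 : 0 <= L by have := normr_ge0 M0; lra.
have D1 : A - B <= w1 - wm by lra.
have MD : 4 * L * (A - B) <= M - A.
  apply: (@le_trans _ _ (4 * L * (w1 - wm))); last lra.
  by apply: ler_wpM2l => //; rewrite mulr_ge0.
rewrite ltrBrDl ltr_pdivlMr //.
move: (A - B) (M - A) D0 MD => D m D0 MD.
have LD : 0 <= L * D by rewrite mulr_ge0 // ltW.
have l00 : 0 <= l by lra.
have := ler_wpM2l l00 MD.
have : 2^-1 * (L * D) <= l * (L * D) by rewrite ler_wpM2r.
have : (L + l / 2 + M0) * D < (2 * L) * D.
  by rewrite ltr_pM2r //; have := ler_norm M0; lra.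
lra.
Qed.

Lemma ratio_small (l L K M0 A B M S w1 wm wf : R) :
  0 <= l <= 1 -> `|M0| + Num.max K 0 + 1 < L -> wm < w1 -> S <= l * (A - B) ->
  wf - w1 <= K * (w1 - wm) -> w1 <= A -> B <= wm -> M <= wf ->
  (l * (M - A) + S) / (A - B) - (L + l / 2) < - M0.
Proof.
move=> /andP[l0 l1]; set K1 := Num.max K 0 => Ln w1m SD far h1 h2 h3.
have K10 : 0 <= K1 by rewrite le_max lexx orbT.
have D1 : w1 - wm <= A - B by lra.
have D0 : 0 < A - B by lra.
have MD : M - A <= K1 * (A - B).
  apply: (@le_trans _ _ (K1 * (w1 - wm))); last by apply: ler_wpM2l.
  have : K * (w1 - wm) <= K1 * (w1 - wm).
    by rewrite ler_wpM2r ?le_max ?lexx // subr_ge0 ltW.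
  lra.
rewrite ltrBlDl ltr_pdivrMr //.
move: (A - B) (M - A) D0 MD SD => D m D0 MD SD.
have := ler_wpM2l l0 MD.
have KD : 0 <= K1 * D by rewrite mulr_ge0 // ltW.
have : l * (K1 * D) <= 1 * (K1 * D) by rewrite ler_wpM2r.
have : l * D <= 1 * D by rewrite ler_wpM2r // ltW.
have : (K1 + 1) * D < (L + l / 2 + - M0) * D.
  by rewrite ltr_pM2r //; have := ler_norm M0; lra.
lra.
Qed.

End LargeAndSmallRatios.

Section RatioBounds.
Variable R : realFieldType.

(** Here m and S are the two parts of the numerator and D the denominator, in the
    units of the scale a.  The relative error eps of D is multiplied by a quantity
    of the size of L = log k, which explains the third condition on eps. *)
Lemma ratio_error (l L x e eps a m S D : R) :
  2^-1 <= l <= 1 -> 0 < e -> 0 < a -> 0 <= eps -> 8 * eps <= 1 ->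
  2 * eps * `|L + l / 2 + x| <= e ->
  `|D - a * l| <= 2 * eps * a -> `|S - a * (l ^+ 2 / 2)| <= 4 * e * a ->
  (m <= a * (L + x - 14 * e) -> (l * m + S) / D - (L + l / 2) <= x) /\
  (a * (L + x + 14 * e) <= m -> x < (l * m + S) / D - (L + l / 2)).
Proof.
move=> /andP[l0 l1] e0 a0 eps0 eps1 hL hD hS.
have D0 : 0 < D.
  move: hD; rewrite ler_norml => /andP[hD _].
  have : a * 2^-1 <= a * l by rewrite ler_pM2l.
  have : a * (8 * eps) <= a * 1 by rewrite ler_pM2l.
  lra.
pose y := L + l / 2 + x.
have yD : `|D * y - a * l * y| <= a * e.
  rewrite -mulrBl normrM; apply: (@le_trans _ _ (2 * eps * a * `|y|)).
    by rewrite ler_wpM2r.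
  by have := ler_wpM2l (ltW a0) hL; rewrite -/y; lra.
have le0 : a * e / 2 <= a * e * l by rewrite ler_pM2l // mulr_gt0.
have ae0 : 0 < a * e by rewrite mulr_gt0.
have yE : a * l * y = a * l * L + a * l * x + a * (l ^+ 2 / 2) by rewrite /y; field.
rewrite yE in yD.
move: yD hS; rewrite !ler_norml => /andP[y1 y2] /andP[s1 s2].
split=> hm.
- rewrite lerBlDl -/y ler_pdivrMr // mulrC.
  have l00 : 0 <= l by lra.
  by have := ler_wpM2l l00 hm; lra.
- rewrite ltrBrDl -/y ltr_pdivlMr // mulrC.
  have l00 : 0 <= l by lra.
  by have := ler_wpM2l l00 hm; lra.
Qed.

End RatioBounds.

Section EndpointWeights.
Variable R : realType.
Implicit Types (k i : nat).

Definition weight k i : R := ln (1 + (k + i)%:R^-1).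

Lemma weight_ge0 k i : 0 <= weight k i.
Proof. by rewrite /weight ln_ge0 // lerDl invr_ge0. Qed.

Lemma weightE k i : (0 < k)%N ->
  weight k i = ln ((k + i.+1)%:R / k%:R) - ln ((k + i)%:R / k%:R).
Proof.
move=> k0; have k0R : 0 < k%:R :> R by rewrite ltr0n.
have ki0 : 0 < (k + i)%:R :> R by rewrite ltr0n addn_gt0 k0.
have ki1 : 0 < (k + i.+1)%:R :> R by rewrite ltr0n addn_gt0 k0.
rewrite -ln_div ?posrE ?divr_gt0 // /weight; congr ln.
rewrite addnS -[(k + i).+1%:R]natr1; move: (k + i)%:R k%:R ki0 k0R => z x z0 x0.
by field; rewrite !gt_eqF.
Qed.

(** The weights are the increments of i |-> log ((k + i) / k). *)
Lemma sum_weight k : (0 < k)%N -> \sum_(0 <= i < k) weight k i = ln 2.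
Proof.
move=> k0; under eq_bigr do rewrite weightE //.
rewrite (telescope_sumr (fun i => ln ((k + i)%:R / k%:R))) // addn0 divff ?ln1 ?subr0; last first.
  by rewrite pnatr_eq0 -lt0n.
by rewrite addnn -mul2n natrM mulfK // pnatr_eq0 -lt0n.
Qed.

(** This is a Riemann sum of x over [0, ln 2] at the points log ((k + i) / k):
    2 (y - x) x = (y^2 - x^2) - (y - x)^2, where the first part telescopes and
    the squares of the weights are negligible because no weight exceeds 1/k. *)
Lemma sum_weight_log k : (0 < k)%N ->
  `|\sum_(0 <= i < k) weight k i * ln ((k + i)%:R / k%:R) - ln 2 ^+ 2 / 2| <= ln 2 / k%:R :> R.
Proof.
move=> k0; have k0R : 0 < k%:R :> R by rewrite ltr0n.
pose l i : R := ln ((k + i)%:R / k%:R).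
have -> : \sum_(0 <= i < k) weight k i * l i =
    \sum_(0 <= i < k) (l i.+1 ^+ 2 - l i ^+ 2) / 2 - \sum_(0 <= i < k) weight k i ^+ 2 / 2.
  rewrite -sumrB; apply: eq_bigr => i _; by rewrite weightE // -/(l i) -/(l i.+1); field.
have -> : \sum_(0 <= i < k) (l i.+1 ^+ 2 - l i ^+ 2) / 2 = (l k ^+ 2 - l 0%N ^+ 2) / 2.
  by rewrite -(telescope_sumr (fun i => l i ^+ 2)) // mulr_suml.
have -> : l 0%N = 0 by rewrite /l addn0 divff ?ln1 // gt_eqF.
have -> : l k = ln 2 by rewrite /l addnn -mul2n natrM mulfK // gt_eqF.
rewrite expr0n subr0 addrAC subrr add0r normrN.
rewrite ger0_norm; last by apply: sumr_ge0 => i _; rewrite divr_ge0 // sqr_ge0.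
rewrite -(sum_weight k0) mulr_suml; apply: ler_sum => i _.
have w1 : weight k i <= k%:R^-1.
  apply: (@le_trans _ _ (k + i)%:R^-1).
    by apply: le_ln1Dx; apply: (@lt_le_trans _ _ 0); [lra|rewrite invr_ge0].
  by rewrite lef_pV2 ?posrE ?ltr0n ?addn_gt0 ?k0 // ler_nat leq_addr.
have w0 := weight_ge0 k i.
have : weight k i * weight k i <= weight k i * k%:R^-1 by rewrite ler_wpM2l.
have : 0 <= weight k i * weight k i by rewrite mulr_ge0.
rewrite expr2; lra.
Qed.

Variables (T : Type) (X : nat -> T -> R).

(** The weighted sum of the endpoint statistic, measured downwards from the order
    statistic of rank n - k. *)
Definition lower_spread n k w : R := \sum_(0 <= i < k)
  weight k i * (order_stat X (n - k) n w - order_stat X (n - (k + i)) n w).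

(** As the weights sum to ln 2, the spread splits into the distance from the
    maximum to the pivot of rank n - k and weighted distances from the pivot to
    lower order statistics. *)
Lemma G_star0E n k w : (0 < k)%N -> G_star0 X n k w =
  (ln 2 * (order_stat X n n w - order_stat X (n - k) n w) + lower_spread n k w) /
  (order_stat X (n - k) n w - order_stat X (n - 2 * k) n w) - (ln k%:R + ln 2 / 2).
Proof.
move=> k0; rewrite /G_star0 /G_stat mulrA; congr (_ / _ - _).
have l2 : ln 2 != 0 :> R by rewrite gt_eqF // ln_gt0 // ltr1n.
rewrite /endpoint_stat /lower_spread.
under [in RHS]eq_bigr do rewrite mulrBr.
rewrite sumrB -mulr_suml sum_weight //.
under [in LHS]eq_bigr do rewrite -subnDA -/(weight k _).
by field.
Qed.

End EndpointWeights.

Section LowerSpread.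
Variables (R : realType) (T : Type) (X : nat -> T -> R).

Lemma lower_spread_approx n k w (a e1 : R) : (0 < k)%N -> 0 <= a -> 0 <= e1 ->
  (forall r, (k <= r <= 2 * k)%N ->
    `|order_stat X (n - k) n w - order_stat X (n - r) n w - a * ln (r%:R / k%:R)| <= e1) ->
  `|lower_spread X n k w - a * (ln 2 ^+ 2 / 2)| <= e1 + a / k%:R.
Proof.
move=> k0 a0 e10 H; have k0R : 0 < k%:R :> R by rewrite ltr0n.
have l1 := ltW (ln2_lt1 R); have l0 : 0 <= ln 2 :> R by have := ln2_ge_half R; lra.
have h1 : `|lower_spread X n k w - a * \sum_(0 <= i < k) weight R k i * ln ((k + i)%:R / k%:R)| <= e1.
  rewrite /lower_spread mulr_sumr -sumrB.
  apply: (@le_trans _ _ (\sum_(0 <= i < k) weight R k i * e1)).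
    apply: (le_trans (ler_norm_sum _ _ _)); apply: ler_sum_nat => i /andP[_ ik].
    rewrite mulrCA -mulrBr normrM ger0_norm ?weight_ge0 // ler_wpM2l ?weight_ge0 //.
    by apply: H; rewrite leq_addr mul2n -addnn leq_add2l ltnW.
  by rewrite -mulr_suml sum_weight // ler_piMl.
have h2 : `|a * \sum_(0 <= i < k) weight R k i * ln ((k + i)%:R / k%:R) - a * (ln 2 ^+ 2 / 2)| <= a / k%:R.
  rewrite -mulrBr normrM ger0_norm // ler_wpM2l //.
  apply: (le_trans (sum_weight_log R k0)).
  by rewrite ler_piMl // invr_ge0.
have := lerD h1 h2; apply: le_trans.
by apply: le_trans (ler_normD _ _); rewrite subrKA.
Qed.

End LowerSpread.

(** * Order statistics and counts *)

Section Counts.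
Context {d : measure_display} {T : measurableType d} {R : realType}.
Variable P : probability T R.
Variables (A : nat -> set T) (p : R).
Hypothesis mA : forall i, measurable (A i).
Hypothesis PA : forall i, P (A i) = p%:E.
Hypothesis PAA : forall i j, i != j -> P (A i `&` A j) = (p * p)%:E.

Definition hits (n : nat) (w : T) : R := \sum_(i < n) \1_(A i) w.

Lemma hitsS n : hits n.+1 = hits n \+ (\1_(A n) : T -> R).
Proof. by apply/funext => w; rewrite /hits big_ord_recr. Qed.

Lemma hits0 : hits 0 = cst 0.
Proof. by apply/funext => w; rewrite /hits big_ord0. Qed.

Lemma Lfun2_indic (B : set T) : measurable B -> (\1_B : T -> R) \in Lfun P 2%:E.
Proof.
move=> mB; rewrite inE/=; apply/andP; split; rewrite inE //=.
rewrite /finite_norm unlock poweR_lty//.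
apply: (@le_lt_trans _ _ (\int[P]_(x in [set: T]) 1%:E)%E); last first.
  rewrite integral_cst // mul1e.
  exact: (le_lt_trans (probability_le1 _ measurableT) (ltry _)).
apply: ge0_le_integral => //.
- by move=> x _; exact: poweR_ge0.
- apply: (@eq_measurable_fun _ _ _ _ _ (fun x => (\1_B x)%:E)).
    move=> x _; rewrite /= ?abse_EFin ?poweR_EFin indicE.
    by case: (_ \in _); rewrite ?normr1 ?powR1 // normr0 powR0.
  by apply/measurable_EFinP; exact: measurable_indic.
- move=> x _; rewrite /= ?abse_EFin ?poweR_EFin lee_fin indicE.
  by case: (_ \in _); rewrite ?normr1 ?powR1 // normr0 powR0.
Qed.

Lemma Lfun2_hits n : hits n \in Lfun P 2%:E.
Proof.
elim: n => [|n IH]; first by rewrite hits0; exact: Lfun_cst.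
have l12 : (1 <= 2%:E :> \bar R)%E by rewrite lee_fin ler1n.
by rewrite hitsS; apply: (Lfun_addr_closed P l12).2 => //; exact: Lfun2_indic.
Qed.

Lemma Lfun2_Lfun1 (f : T -> R) : f \in Lfun P 2%:E -> f \in Lfun P 1.
Proof. by move=> f2; apply: Lfun_subset12 f2; exact: fin_num_measure. Qed.

Lemma expectation_hits n : ('E_P[hits n] = (n%:R * p)%:E)%E.
Proof.
elim: n => [|n IH]; first by rewrite hits0 expectation_cst mul0r.
rewrite hitsS expectationD ?Lfun2_Lfun1 ?Lfun2_hits ?Lfun2_indic //.
by rewrite IH expectation_indic // PA -EFinD -natr1 mulrDl mul1r.
Qed.

Lemma covariance_indic i j : i != j -> covariance P (\1_(A i)) (\1_(A j)) = 0%E.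
Proof.
move=> ij; have l2 k : (\1_(A k) : T -> R) \in Lfun P 2%:E by exact: Lfun2_indic.
rewrite (covarianceE (Lfun2_Lfun1 (l2 i)) (Lfun2_Lfun1 (l2 j)) (Lfun2_mul_Lfun1 (l2 i) (l2 j))).
have -> : (\1_(A i) * \1_(A j) = \1_(A i `&` A j) :> (T -> R)).
  by rewrite indicI.
rewrite expectation_indic; last exact: measurableI.
by rewrite !expectation_indic // PAA // !PA -EFinM -EFinB subrr.
Qed.

Lemma covariance_hits m n : (m <= n)%N -> covariance P (hits m) (\1_(A n)) = 0%E.
Proof.
elim: m => [|m IH] mn; first by rewrite hits0 covariance_cst_l.
rewrite hitsS covarianceDl ?Lfun2_hits ?Lfun2_indic //.
by rewrite IH ?(ltnW mn) // covariance_indic ?addr0 ?adde0 // ltn_eqF.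
Qed.

Lemma variance_hits n : ('V_P[hits n] <= (n%:R * p)%:E)%E.
Proof.
elim: n => [|n IH]; first by rewrite hits0 variance_cst mul0r.
rewrite hitsS varianceD ?Lfun2_hits ?Lfun2_indic //.
rewrite covariance_hits // mule0 adde0 -natr1 mulrDl mul1r EFinD; apply: leeD => //.
rewrite varianceE ?Lfun2_indic //.
have -> : (\1_(A n) ^+ 2 = \1_(A n) :> (T -> R)).
  by rewrite -[in RHS](setIid (A n)) indicI expr2.
rewrite expectation_indic // PA -EFin_expe -EFinB lee_fin lerBlDr lerDl.
exact: sqr_ge0.
Qed.

(** Chebyshev's inequality; pairwise independence makes the variance at most the
    mean. *)
Lemma hits_deviation n (e : R) : 0 < e ->
  (P [set w | (e <= `|hits n w - n%:R * p|)%R] <= (n%:R * p / e ^+ 2)%:E)%E.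
Proof.
move=> e0.
have mh : hits n \in mfun by have := Lfun2_hits n; exact: sub_Lfun_mfun.
pose H : {RV P >-> R} := mfun_Sub mh.
have := chebyshev H e0; rewrite /H /= expectation_hits /=.
move=> /le_trans; apply; rewrite mulrC EFinM; apply: lee_pmul => //.
- by rewrite lee_fin invr_ge0 exprn_ge0 // ltW.
- exact: variance_ge0.
- exact: variance_hits.
Qed.

Lemma measurable_hits n : measurable_fun setT (hits n).
Proof. by have := Lfun2_hits n; move=> /sub_Lfun_mfun; rewrite inE. Qed.

End Counts.

Section OrderStatistics.
Context {d : measure_display} {T : measurableType d} {R : realType}.
Variable X : nat -> {mfun T >-> R}.
Implicit Types (n r : nat) (w : T) (x : R).

Lemma hits_count (B : set R) n w :
  hits (R := R) (fun i => X i @^-1` B) n w =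
  (count (fun y => `[< B y >]) [seq X i w | i <- iota 0 n])%:R.
Proof.
rewrite /hits -(big_mkord xpredT (fun i => \1_(X i @^-1` B) w : R)) count_map.
rewrite -sum1_count [in RHS]big_mkcond natr_sum /index_iota subn0; apply: eq_bigr => i _.
rewrite indicE /=; case: ifPn => [/asboolP Bi|/asboolPn Bi].
  by rewrite mem_set.
by rewrite memNset.
Qed.

Lemma order_stat_leP n r w x : (r < n)%N ->
  (order_stat X (n - r) n w <= x) =
  (hits (R := R) (fun i => X i @^-1` `]x, +oo[) n w <= r%:R).
Proof.
move=> rn; rewrite hits_count ler_nat /order_stat.
set s := [seq X i w | i <- iota 0 n].
have szs : size s = n by rewrite size_map size_iota.
have -> : count (fun y => `[< `]x, +oo[%classic y >]) s = (n - count (<= x)%R s)%N.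
  rewrite count_le_gt szs subKn; last by rewrite -szs count_size.
  by apply: eq_count => y /=; rewrite asboolb in_itv /= andbT.
have cp : count (<= x)%R (sort <=%O s) = count (<= x)%R s by apply/permP; rewrite perm_sort.
have cn : (count (<= x)%R s <= n)%N by rewrite -szs count_size.
have [h|h] := ltnP (n - r).-1 (count (<= x)%R s).
  rewrite nth_count_le ?cp //; last by apply: sort_le_sorted.
  apply/esym; rewrite leq_subLR addnC -leq_subLR.
  by rewrite -(prednK (_ : 0 < n - r)%N) ?subn_gt0.
have -> : (n - count (<= x)%R s <= r)%N = false.
  apply/negbTE; rewrite leq_subLR addnC -leq_subLR -ltnNge.
  by rewrite -(prednK (_ : 0 < n - r)%N) ?subn_gt0.
apply/negbTE; rewrite -ltNge nth_count_gt ?sort_le_sorted //.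
by rewrite cp h size_sort szs prednK ?subn_gt0 // leq_subr.
Qed.

Lemma order_stat_geP n r w x : (r < n)%N ->
  (x <= order_stat X (n - r) n w) =
  (r.+1%:R <= hits (R := R) (fun i => X i @^-1` `[x, +oo[) n w).
Proof.
move=> rn; rewrite hits_count ler_nat /order_stat.
set s := [seq X i w | i <- iota 0 n].
have szs : size s = n by rewrite size_map size_iota.
have -> : count (fun y => `[< `[x, +oo[%classic y >]) s = (n - count (< x)%R s)%N.
  rewrite count_lt_ge szs subKn; last by rewrite -szs count_size.
  by apply: eq_count => y /=; rewrite asboolb in_itv /= andbT.
have cp : count (< x)%R (sort <=%O s) = count (< x)%R s by apply/permP; rewrite perm_sort.
have cn : (count (< x)%R s <= n)%N by rewrite -szs count_size.
have -> : (r < n - count (< x)%R s)%N = (count (< x)%R s <= (n - r).-1)%N.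
  rewrite ltn_subRL addnC -ltn_subRL -[in LHS](prednK (_ : 0 < n - r)%N) ?subn_gt0 //.
have [h|h] := leqP (count (< x)%R s) (n - r).-1.
  rewrite nth_count_ge ?sort_le_sorted //.
  by rewrite cp h size_sort szs prednK ?subn_gt0 // leq_subr.
by apply/negbTE; rewrite -ltNge nth_count_lt ?cp // sort_le_sorted.
Qed.

Lemma order_stat_anti n r r' w : (r <= r')%N -> (r' < n)%N ->
  order_stat X (n - r') n w <= order_stat X (n - r) n w.
Proof.
move=> rr' r'n; rewrite order_stat_leP //.
have := lexx (order_stat X (n - r) n w); rewrite order_stat_leP; last exact: leq_ltn_trans r'n.
by move=> /le_trans; apply; rewrite ler_nat.
Qed.

(** For n <= r the rank n - r is 0, which order_stat treats as rank 1. *)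
Lemma measurable_order_stat n r : measurable_fun setT (order_stat X (n - r) n).
Proof.
have [->|n0] := posnP n.
  by rewrite (_ : order_stat X (0 - r) 0 = cst 0) //; apply/funext => w; rewrite /order_stat /= nth_nil.
have key q : (q < n)%N -> measurable_fun setT (order_stat X (n - q) n).
  move=> qn; apply: (measurability _ (RGenOInfty.measurableE R)) => //.
  move=> /= _ [_ [x ->] <-]; rewrite setTI -[X in measurable X]setCK; apply: measurableC.
  rewrite (_ : ~` _ = [set w | hits (R := R) (fun i => X i @^-1` `]x, +oo[) n w <= q%:R]).
    have mh : measurable_fun setT (hits (R := R) (fun i => X i @^-1` `]x, +oo[) n).
      rewrite (_ : hits _ n = (fun w => \sum_(i < n) (\1_(X i @^-1` `]x, +oo[) : T -> R) w)) //.
      apply: measurable_sum => i; apply: measurable_indic; exact: measurable_funPTI.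
    rewrite -[X in measurable X]setTI.
    have -> : [set w | hits (R := R) (fun i => X i @^-1` `]x, +oo[) n w <= q%:R] =
      hits (R := R) (fun i => X i @^-1` `]x, +oo[) n @^-1` `]-oo, q%:R].
      by apply/seteqP; split=> w /=; rewrite in_itv.
    exact: mh.
  apply/seteqP; split=> w /=; rewrite in_itv /= andbT -order_stat_leP //.
    by move=> /negP; rewrite -leNgt.
  by move=> h; apply/negP; rewrite -leNgt.
have [|nr] := ltnP r n; first exact: key.
have -> : order_stat X (n - r) n = order_stat X (n - n.-1) n.
  move: nr; rewrite -subn_eq0 => /eqP ->.
  by rewrite -[X in (X - _)%N](prednK n0) subSnn.
by apply: key; rewrite prednK.
Qed.

End OrderStatistics.

(** * The tail quantile function and independent samples *)

Section TailQuantile.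
Context {d : measure_display} {T : measurableType d} {R : realType}.
Variables (P : probability T R) (Y : {RV P >-> R}) (F : R -> R).
Hypothesis cdfF : forall x, cdf Y x = (F x)%:E.
Notation U := (tail_quantile F).

Let FE : F = fine \o cdf Y. Proof. by apply/funext => x /=; rewrite cdfF. Qed.

Lemma cdf_cvg1 : F x @[x --> +oo] --> (1 : R).
Proof.
have /fine_cvgP[_] := cvg_cdfy1 Y.
by rewrite FE.
Qed.

Lemma cdf_cvg0 : F x @[x --> -oo] --> (0 : R).
Proof.
have /fine_cvgP[_] := cvg_cdfNy0 Y.
by rewrite FE.
Qed.

Lemma cdf_rcont (x : R) : F y @[y --> x^'+] --> F x.
Proof.
have := @cdf_right_continuous _ _ _ P Y x.
by rewrite cdfF => /fine_cvgP[_]; rewrite FE.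
Qed.

Lemma has_inf_tail_quantile t : 1 < t -> has_inf [set x | 1 - t^-1 <= F x].
Proof.
move=> t1; have t0 : 0 < t by apply: lt_trans t1.
have ti1 : t^-1 < 1 by rewrite invf_lt1.
have ti0 : 0 < t^-1 by rewrite invr_gt0.
split.
  have [M [_ HM]] : \forall x \near +oo, 1 - t^-1 < F x.
    by apply: (cvgr_gt _ cdf_cvg1); lra.
  by exists (M + 1); apply/ltW/HM; rewrite ltrDl.
have [M [_ HM]] : \forall x \near -oo, F x < 1 - t^-1.
  by apply: (cvgr_lt _ cdf_cvg0); lra.
exists (M - 1) => x /= xF; rewrite leNgt; apply/negP => xM.
by have := HM x ltac:(lra); rewrite ltNge xF.
Qed.

Lemma tail_quantile_lt t x : 1 < t -> x < U t -> F x < 1 - t^-1.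
Proof.
move=> t1 xU; rewrite ltNge; apply/negP => xF; move: xU; apply/negP; rewrite -leNgt.
by apply: ge_inf => //; have [] := has_inf_tail_quantile t1.
Qed.

(** The infimum is attained, by right continuity. *)
Lemma cdf_tail_quantile t : 1 < t -> 1 - t^-1 <= F (U t).
Proof.
move=> t1; have hi := has_inf_tail_quantile t1.
rewrite leNgt; apply/negP => FU.
have [e /= e0 He] : \forall y \near (U t)^'+, F y < 1 - t^-1.
  exact: (cvgr_lt _ (@cdf_rcont (U t))).
have [y yF yU] := inf_adherent e0 hi.
have Uy : U t <= y by apply: ge_inf => //; case: hi.
move: yF; rewrite /= leNgt => /negP; apply.
have [Uy'|] := ltP (U t) y; last by move=> yU'; rewrite (le_anti _ : y = U t) // yU' Uy.
apply: He => //=; rewrite distrC ger0_norm ?subr_ge0 //.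
by rewrite ltrBlDl.
Qed.

Lemma tail_quantile_homo s t : 1 < s -> s <= t -> U s <= U t.
Proof.
move=> s1 st; apply: lb_le_inf.
  by case: (has_inf_tail_quantile (lt_le_trans s1 st)).
move=> x /= xF; apply: ge_inf; first by case: (has_inf_tail_quantile s1).
apply: le_trans xF; rewrite lerB // lef_pV2 ?posrE //; lra.
Qed.

Lemma prob_gt x : P (Y @^-1` `]x, +oo[) = (1 - F x)%:E.
Proof.
have := cdf_ccdf_1 Y x; rewrite /ccdf /distribution /pushforward cdfF => h.
have fP : P (Y @^-1` `]x, +oo[) \is a fin_num by apply: fin_num_measure; exact: measurable_funPTI.
by rewrite -(fineK fP) in h *; congr EFin; move: h => [] <-; ring.
Qed.

Lemma prob_lt_cvg (x : R) : (F (x - m.+1%:R^-1))%:E @[m --> \oo] --> P (Y @^-1` `]-oo, x[).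
Proof.
pose G m := Y @^-1` `]-oo, (x - m.+1%:R^-1)].
have -> : Y @^-1` `]-oo, x[ = \bigcup_m G m.
  apply/seteqP; split=> w /=.
    rewrite in_itv /= => wx; have xw : 0 < x - Y w by rewrite subr_gt0.
    have [m mx] := ltr_add_invr wx.
    by exists m => //; rewrite /G /= in_itv /= lerBrDr ltW.
  move=> [m _]; rewrite /G /= !in_itv /= => /le_lt_trans; apply.
  by rewrite ltrBlDr ltrDl invr_gt0.
have -> : (fun m => (F (x - m.+1%:R^-1))%:E) = P \o G.
  by apply/funext => m /=; rewrite -cdfF.
apply: nondecreasing_cvg_mu.
- by move=> m; exact: measurable_funPTI.
- by apply: bigcup_measurable => m _; exact: measurable_funPTI.
- move=> m n mn; apply/subsetPset; apply: preimage_subset; apply: subset_itvl.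
  by rewrite bnd_simp lerB // lef_pV2 ?posrE // ler_nat.
Qed.

Lemma prob_gt_tail_quantile t : 1 < t -> (P (Y @^-1` `]U t, +oo[) <= (t^-1)%:E)%E.
Proof.
by move=> t1; rewrite prob_gt lee_fin; have := cdf_tail_quantile t1; lra.
Qed.

(** F may jump at U t: one-sided bounds on P (Y < U t) and on P (Y > U t) replace
    the continuity of F. *)
Lemma prob_lt_tail_quantile t : 1 < t -> (P (Y @^-1` `]-oo, U t[) <= (1 - t^-1)%:E)%E.
Proof.
move=> t1; have cv := @prob_lt_cvg (U t).
rewrite -(cvg_lim _ cv) //; apply: lime_le; first by apply/cvg_ex; eexists; exact: cv.
apply: nearW => m; rewrite lee_fin ltW // tail_quantile_lt //.
by rewrite ltrBlDr ltrDl invr_gt0.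
Qed.

Lemma prob_ge_tail_quantile t : 1 < t -> ((t^-1)%:E <= P (Y @^-1` `[U t, +oo[))%E.
Proof.
move=> t1; have -> : Y @^-1` `[U t, +oo[ = ~` (Y @^-1` `]-oo, U t[).
  apply/seteqP; split=> w /=; rewrite !in_itv /= andbT.
    by move=> h; apply/negP; rewrite -leNgt.
  by move=> /negP; rewrite -leNgt.
rewrite probability_setC; last exact: measurable_funPTI.
have := prob_lt_tail_quantile t1.
have fP : P (Y @^-1` `]-oo, U t[) \is a fin_num by apply: fin_num_measure; exact: measurable_funPTI.
by rewrite -(fineK fP) -EFinB !lee_fin; lra.
Qed.

End TailQuantile.

Section Iid.
Context {d : measure_display} {T : measurableType d} {R : realType}.
Variables (P : probability T R) (X : nat -> {RV P >-> R}) (F : R -> R).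
Hypothesis X_iid : iid X F.
Notation U := (tail_quantile F).

Let cdfX i x : cdf (X i) x = (F x)%:E. Proof. by have [_] := X_iid. Qed.

(** Identity of the distribution functions passes to open half-lines by
    continuity of P along x - 1/(m+1). *)
Lemma prob_ge_identical i x : P (X i @^-1` `[x, +oo[) = P (X 0 @^-1` `[x, +oo[).
Proof.
have C j : X j @^-1` `[x, +oo[ = ~` (X j @^-1` `]-oo, x[).
  apply/seteqP; split=> w /=; rewrite !in_itv /= andbT.
    by move=> h; apply/negP; rewrite -leNgt.
  by move=> /negP; rewrite -leNgt.
rewrite !C !probability_setC; try exact: measurable_funPTI.
by rewrite (cvg_unique _ (@prob_lt_cvg _ _ _ _ _ _ (cdfX i) x) (@prob_lt_cvg _ _ _ _ _ _ (cdfX 0) x)).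
Qed.

Lemma prob_iid_pair (B : set R) (p : R) : measurable B ->
  (forall i, P (X i @^-1` B) = p%:E) ->
  forall i j, i != j -> P (X i @^-1` B `&` X j @^-1` B) = (p * p)%:E.
Proof.
move=> mB Bp i j ij; have [indep _] := X_iid.
have := indep [fset i; j]%fset (fun=> B) (fun=> mB).
have -> : \bigcap_(k in [set` [fset i; j]%fset]) X k @^-1` B = X i @^-1` B `&` X j @^-1` B.
  apply/seteqP; split=> w /=.
    by move=> h; split; apply: h => /=; rewrite !inE eqxx ?orbT.
  by move=> [h1 h2] k /=; rewrite !inE => /orP[/eqP ->|/eqP ->].
move=> ->; rewrite big_fsetU1 ?inE //= big_seq_fset1 !Bp //.
Qed.

Lemma prob_iid_all (B : set R) (p : R) n : measurable B ->
  (forall i, P (X i @^-1` B) = p%:E) ->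
  P [set w | forall i, (i < n)%N -> B (X i w)] = (p ^+ n)%:E.
Proof.
move=> mB Bp; have [indep _] := X_iid.
have := indep [fset i in iota 0 n]%fset (fun=> B) (fun=> mB).
have -> : \bigcap_(k in [set` [fset i in iota 0 n]%fset]) X k @^-1` B =
    [set w | forall i, (i < n)%N -> B (X i w)].
  apply/seteqP; split=> w /= h k.
    by move=> kn; apply: h => /=; rewrite !inE /= mem_iota.
  by rewrite /= !inE /= mem_iota => /h.
move=> ->; rewrite (eq_bigr (fun=> p%:E)); last by move=> i _; exact: Bp.
rewrite (perm_big (iota 0 n)).
  elim: n => [|n IH]; first by rewrite big_nil expr0.
  by rewrite -[n.+1]addn1 iotaD big_cat /= IH big_seq1 addn1 exprSr EFinM.
apply: uniq_perm; [exact: fset_uniq|exact: iota_uniq|].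
by move=> i; rewrite !inE /=.
Qed.

(** If the order statistic exceeds U t, more than r of the n variables exceed
    U t, while at most n/t are expected to. *)
Lemma order_stat_gt_bound n r t : (r < n)%N -> 1 < t -> n%:R / t < r%:R ->
  (P [set w | (U t < order_stat X (n - r) n w)%R] <=
    (n%:R / t / (r%:R - n%:R / t) ^+ 2)%:E)%E.
Proof.
move=> rn t1 ntr; have t0 : 0 < t by lra.
pose A i := X i @^-1` `]U t, +oo[; pose p := 1 - F (U t).
have mA i : measurable (A i) by exact: measurable_funPTI.
have PA i : P (A i) = p%:E by exact: prob_gt.
have PAA := prob_iid_pair (measurable_itv `]U t, +oo[) PA.
have pt : p <= t^-1 by rewrite -lee_fin -(PA 0); exact: prob_gt_tail_quantile.
have e0 : 0 < r%:R - n%:R / t by rewrite subr_gt0.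
have npt : n%:R * p <= n%:R / t by rewrite ler_wpM2l.
apply: (@le_trans _ _ (n%:R * p / (r%:R - n%:R / t) ^+ 2)%:E); last first.
  by rewrite lee_fin ler_wpM2r // invr_ge0 sqr_ge0.
apply: le_trans (hits_deviation mA PA PAA n e0); apply: le_measure; rewrite ?inE.
- rewrite (_ : [set w | _] = order_stat X (n - r) n @^-1` `]U t, +oo[).
    by rewrite -[X in measurable X]setTI; apply: measurable_order_stat.
  by apply/seteqP; split=> w /=; rewrite in_itv /= andbT.
- rewrite (_ : [set w | _] = (fun w => `|hits A n w - n%:R * p|) @^-1` `[r%:R - n%:R / t, +oo[).
    rewrite -[X in measurable X]setTI.
    apply: (_ : measurable_fun setT (fun w => `|hits A n w - n%:R * p|)) => //.
    apply: measurableT_comp => //; apply: measurable_funB => //.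
    exact: measurable_hits.
  by apply/seteqP; split=> w /=; rewrite in_itv /= andbT.
move=> w /=; rewrite ltNge order_stat_leP // -ltNge => h.
by rewrite ler_normr; apply/orP; left; lra.
Qed.

Lemma deviation_ratio_le (x y r : R) : 0 <= r -> r < x -> x <= y ->
  y / (y - r) ^+ 2 <= x / (x - r) ^+ 2.
Proof.
move=> r0 rx xy.
rewrite ler_pdivrMr ?exprn_gt0 ?subr_gt0 ?(lt_le_trans rx) // mulrAC.
rewrite ler_pdivlMr ?exprn_gt0 ?subr_gt0 // -subr_ge0.
have -> : x * (y - r) ^+ 2 - y * (x - r) ^+ 2 = (y - x) * (x * y - r * r) by ring.
apply: mulr_ge0; first by rewrite subr_ge0.
by rewrite subr_ge0; apply: ler_pM => //; lra.
Qed.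

(** If the order statistic is below U t, at most r of the n variables reach U t,
    while at least n/t are expected to. *)
Lemma order_stat_lt_bound n r t : (r < n)%N -> 1 < t -> r%:R < n%:R / t ->
  (P [set w | (order_stat X (n - r) n w < U t)%R] <=
    (n%:R / t / (n%:R / t - r%:R) ^+ 2)%:E)%E.
Proof.
move=> rn t1 ntr; have t0 : 0 < t by lra.
pose A i := X i @^-1` `[U t, +oo[; pose p := fine (P (A 0)).
have mA i : measurable (A i) by exact: measurable_funPTI.
have PA i : P (A i) = p%:E.
  by rewrite /p fineK ?fin_num_measure // /A (prob_ge_identical i).
have PAA := prob_iid_pair (measurable_itv `[U t, +oo[) PA.
have pt : t^-1 <= p by rewrite -lee_fin -(PA 0); exact: prob_ge_tail_quantile.
have npt : n%:R / t <= n%:R * p by rewrite ler_wpM2l.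
have e0 : 0 < n%:R * p - r%:R by lra.
apply: (@le_trans _ _ (n%:R * p / (n%:R * p - r%:R) ^+ 2)%:E); last first.
  by rewrite lee_fin; apply: deviation_ratio_le.
apply: le_trans (hits_deviation mA PA PAA n e0); apply: le_measure; rewrite ?inE.
- rewrite (_ : [set w | _] = order_stat X (n - r) n @^-1` `]-oo, U t[).
    by rewrite -[X in measurable X]setTI; apply: measurable_order_stat.
  by apply/seteqP; split=> w /=; rewrite in_itv /=.
- rewrite (_ : [set w | _] = (fun w => `|hits A n w - n%:R * p|) @^-1` `[n%:R * p - r%:R, +oo[).
    rewrite -[X in measurable X]setTI.
    apply: (_ : measurable_fun setT (fun w => `|hits A n w - n%:R * p|)) => //.
    apply: measurableT_comp => //; apply: measurable_funB => //.
    exact: measurable_hits.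
  by apply/seteqP; split=> w /=; rewrite in_itv /= andbT.
move=> w /=; rewrite ltNge order_stat_geP // -ltNge hits_count ltr_nat ltnS -(ler_nat R) => h.
by rewrite ler_normr; apply/orP; right; rewrite opprB lerD2l lerN2.
Qed.

Lemma order_stat_max_leP n x w : (0 < n)%N ->
  (order_stat X n n w <= x) <-> (forall i, (i < n)%N -> X i w <= x).
Proof.
move=> n0; have := order_stat_leP X w x n0; rewrite subn0 => ->.
rewrite hits_count ler_nat leqn0 -[_ == 0%N]negbK -lt0n -has_count -all_predC.
split.
  move=> /allP h i iN; have : X i w \in [seq X j w | j <- iota 0 n].
    by apply: (map_f (fun j => X j w)); rewrite mem_iota.
  by move=> /h; rewrite /= asboolb in_itv /= andbT -leNgt.
move=> h; apply/allP => y /mapP[i]; rewrite mem_iota => /h iN ->.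
by rewrite /= asboolb in_itv /= andbT -leNgt.
Qed.

Lemma order_stat_max_ltP n x w : (0 < n)%N ->
  (order_stat X n n w < x) <-> (forall i, (i < n)%N -> X i w < x).
Proof.
move=> n0; have := order_stat_geP X w x n0; rewrite subn0 ltNge => ->.
rewrite hits_count ler_nat -has_count -all_predC.
split.
  move=> /allP h i iN; have : X i w \in [seq X j w | j <- iota 0 n].
    by apply: (map_f (fun j => X j w)); rewrite mem_iota.
  by move=> /h; rewrite /= asboolb in_itv /= andbT -ltNge.
move=> h; apply/allP => y /mapP[i]; rewrite mem_iota => /h iN ->.
by rewrite /= asboolb in_itv /= andbT -ltNge.
Qed.

Lemma prob_max_le n t : (0 < n)%N -> 1 < t ->
  (((1 - t^-1) ^+ n)%:E <= P [set w | (order_stat X n n w <= U t)%R])%E.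
Proof.
move=> n0 t1; pose p := F (U t).
have PA i : P (X i @^-1` `]-oo, U t]) = p%:E by rewrite -(cdfX i).
have -> : [set w | (order_stat X n n w <= U t)%R] =
    [set w | forall i, (i < n)%N -> `]-oo, U t]%classic (X i w)].
  apply/seteqP; split=> w /=.
    by move=> /(order_stat_max_leP _ _ n0) h i /h; rewrite in_itv.
  by move=> h; apply/(order_stat_max_leP _ _ n0) => i /h; rewrite in_itv.
rewrite (prob_iid_all n _ PA) // lee_fin; apply: lerXn2r; rewrite ?nnegrE.
- by rewrite subr_ge0 invf_le1 ?ltW //; lra.
- by rewrite -lee_fin -(PA 0).
- exact: (cdf_tail_quantile (cdfX 0)).
Qed.

Lemma prob_max_lt n t : (0 < n)%N -> 1 < t ->
  (P [set w | (order_stat X n n w < U t)%R] <= ((1 - t^-1) ^+ n)%:E)%E.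
Proof.
move=> n0 t1; pose p := fine (P (X 0 @^-1` `]-oo, U t[)).
have PA i : P (X i @^-1` `]-oo, U t[) = p%:E.
  rewrite /p fineK; last by apply: fin_num_measure; exact: measurable_funPTI.
  exact: (cvg_unique _ (@prob_lt_cvg _ _ _ _ _ _ (cdfX i) _) (@prob_lt_cvg _ _ _ _ _ _ (cdfX 0) _)).
have -> : [set w | (order_stat X n n w < U t)%R] =
    [set w | forall i, (i < n)%N -> `]-oo, U t[%classic (X i w)].
  apply/seteqP; split=> w /=.
    by move=> /(order_stat_max_ltP _ _ n0) h i /h; rewrite in_itv.
  by move=> h; apply/(order_stat_max_ltP _ _ n0) => i /h; rewrite in_itv.
rewrite (prob_iid_all n _ PA) // lee_fin; apply: lerXn2r; rewrite ?nnegrE.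
- by rewrite -lee_fin -(PA 0).
- by rewrite subr_ge0 invf_le1 ?ltW //; lra.
- rewrite -lee_fin -(PA 0); exact: (prob_lt_tail_quantile (cdfX 0)).
Qed.

End Iid.

(** * Events with probability tending to one *)

Section WithHighProbability.
Context {d : measure_display} {T : measurableType d} {R : realType}.
Variable P : probability T R.
Implicit Types (E B : nat -> set T).

(** Stated through measurable exceptional sets, so that the events themselves need
    not be measurable. *)
Definition whp E := exists B, [/\ forall n, measurable (B n),
  P (B n) @[n --> \oo] --> 0%E & \forall n \near \oo, ~` B n `<=` E n].

Lemma whp_bound B (e : nat -> R) : (forall n, measurable (B n)) ->
  (\forall n \near \oo, (P (B n) <= (e n)%:E)%E) -> e n @[n --> \oo] --> (0 : R) ->
  whp (fun n => ~` B n).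
Proof.
move=> mB Be e0; exists B; split => //; last by apply: nearW => n.
apply: (@squeeze_cvge _ _ _ _ (cst 0%E) _ (fun n => (e n)%:E)).
- by near=> n; rewrite measure_ge0 /=; near: n.
- exact: cvg_cst.
- by apply: cvg_EFin => //; exact: nearW.
Unshelve. all: by end_near.
Qed.

Lemma whpS E E' : whp E -> (\forall n \near \oo, E n `<=` E' n) -> whp E'.
Proof.
move=> [B [mB PB BE]] EE'; exists B; split => //.
by near=> n; apply: (@subset_trans _ (E n)); near: n.
Unshelve. all: by end_near.
Qed.

Lemma whpI E E' : whp E -> whp E' -> whp (fun n => E n `&` E' n).
Proof.
move=> [B [mB PB BE]] [B' [mB' PB' BE']]; exists (fun n => B n `|` B' n); split.
- by move=> n; exact: measurableU.
- have c0 : (P (B n) + P (B' n))%E @[n --> \oo] --> 0%E.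
    by rewrite -[0%E]adde0; apply: cvgeD.
  apply: (squeeze_cvge _ (cvg_cst _) c0).
  by apply: nearW => n; rewrite measure_ge0 /=; exact: measureU2.
- near=> n; rewrite setCU; apply: setISS; by near: n.
Unshelve. all: by end_near.
Qed.

Lemma whp_forall (m : nat) (E : nat -> nat -> set T) : (forall j, (j < m)%N -> whp (E j)) ->
  whp (fun n => [set w | forall j, (j < m)%N -> E j n w]).
Proof.
elim: m => [|m IH] HE.
  exists (fun=> set0); split => //; first by under eq_fun do rewrite measure0; exact: cvg_cst.
  by apply: nearW.
have := whpI (IH (fun j jm => HE j (ltnW jm))) (HE m (ltnSn m)).
move=> /whpS; apply; apply: nearW => n w [h1 h2] j.
by rewrite ltnS leq_eqVlt => /orP[/eqP ->|/h1].
Qed.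

Lemma whp_near (E : nat -> Prop) : (\forall n \near \oo, E n) -> whp (fun n => [set w | E n]).
Proof.
move=> En; exists (fun=> set0); split => //; first by under eq_fun do rewrite measure0; exact: cvg_cst.
by near=> n => w _; near: n.
Unshelve. all: by end_near.
Qed.

End WithHighProbability.

Section ProbabilityLimits.
Context {d : measure_display} {T : measurableType d} {R : realType}.
Variable P : probability T R.

Lemma cvg_prob (E : nat -> set T) (l : R) : (forall n, measurable (E n)) ->
  (forall e, 0 < e -> \forall n \near \oo, ((l - e)%:E <= P (E n))%E) ->
  (forall e, 0 < e -> \forall n \near \oo, (P (E n) <= (l + e)%:E)%E) ->
  P (E n) @[n --> \oo] --> l%:E.
Proof.
move=> mE lo up.
have fE n : P (E n) \is a fin_num by apply: fin_num_measure; exact: mE.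
apply: cvg_EFin; first exact: nearW.
apply/cvgrPdist_le => e e0; near=> n.
have h1 : ((l - e)%:E <= P (E n))%E by near: n; exact: lo.
have h2 : (P (E n) <= (l + e)%:E)%E by near: n; exact: up.
move: h1 h2; rewrite -(fineK (fE n)) !lee_fin => h1 h2 /=.
by rewrite ler_norml; apply/andP; split; lra.
Unshelve. all: by end_near.
Qed.

Lemma cvg_prob1 (E : nat -> set T) : (forall n, measurable (E n)) ->
  (forall e, 0 < e -> \forall n \near \oo, ((1 - e)%:E <= P (E n))%E) ->
  P (E n) @[n --> \oo] --> 1%E.
Proof.
move=> mE lo; apply: cvg_prob => // e e0; apply: nearW => n.
by apply: (le_trans (probability_le1 _ (mE n))); rewrite lee_fin lerDl ltW.
Qed.

End ProbabilityLimits.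

(** * Intermediate order statistics and the maximum *)

Lemma measurable_invr (R : realType) : measurable_fun [set: R] (@GRing.inv R).
Proof.
have -> : [set: R] = [set 0] `|` ~` [set 0] by rewrite setUv.
have m0 : measurable ([set 0] : set R) by [].
apply/measurable_funU => //; first exact: measurableC.
split; first exact: measurable_fun_set1.
apply: subspace_continuous_measurable_fun; first exact: measurableC.
apply: continuous_in_subspaceT => x; rewrite inE /= => /eqP x0.
exact: inv_continuous.
Qed.

(** The tail quantile function in the variable log t, which turns the scalings
    U (t x) into translations. *)
Definition log_quantile (R : realType) (F : R -> R) (x : R) : R :=
  tail_quantile F (expR x).

Definition log_spacing (R : realType) (k : nat -> nat) (n : nat) : R :=
  ln (n%:R / (k n)%:R).

Definition log_rank (R : realType) (k : nat -> nat) (n : nat) : R := ln (k n)%:R.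

Section MeasurableStatistics.
Context {d : measure_display} {T : measurableType d} {R : realType}.
Variables (P : probability T R) (X : nat -> {RV P >-> R}).

Lemma measurable_G_star0 n k : measurable_fun setT (G_star0 X n k).
Proof.
have os r : measurable_fun setT (order_stat X (n - r) n) by exact: measurable_order_stat.
have osn : measurable_fun setT (order_stat X n n) by rewrite -[X in order_stat _ X](subn0 n).
have me : measurable_fun setT (endpoint_stat X n k).
  apply: measurable_funB; first exact: measurable_funD.
  apply: measurable_funM => //; apply: measurable_sum => i.
  apply: measurable_funM => //; rewrite (_ : order_stat X _ n = order_stat X (n - (k + i)) n) //.
  by rewrite subnDA.
apply: measurable_funB => //; apply: measurable_funM => //.
apply: measurable_funM; first exact: measurable_funB.
by apply: measurableT_comp; [exact: measurable_invr|exact: measurable_funB].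
Qed.

End MeasurableStatistics.

Section Thresholds.
Context {d : measure_display} {T : measurableType d} {R : realType}.
Variables (P : probability T R) (X : nat -> {RV P >-> R}) (F : R -> R).
Hypothesis X_iid : iid X F.
Variable k : nat -> nat.
Hypothesis k_gt0 : forall n, (0 < k n)%N.
Hypothesis k_infty : k n @[n --> \oo] --> \oo.
Hypothesis k_small : (k n)%:R / n%:R @[n --> \oo] --> (0 : R).

Local Notation W := (log_quantile F).
Local Notation s := (@log_spacing R k).
Local Notation L := (@log_rank R k).

Let kR0 n : 0 < (k n)%:R :> R. Proof. by rewrite ltr0n. Qed.

Lemma log_quantile_homo : {in `]0, +oo[ &, {homo W : x y / x <= y}}.
Proof.
move=> x y; rewrite !in_itv /= !andbT => x0 y0 xy.
have [_ cdfX] := X_iid.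
by apply: (tail_quantile_homo (cdfX 0)); rewrite ?expR_gt1 // ler_expR.
Qed.

Lemma k_infty_ge (M : R) : \forall n \near \oo, M <= (k n)%:R.
Proof.
have [m Mm] : exists m : nat, M <= m%:R.
  by exists (Num.truncn `|M|).+1; apply: (le_trans (ler_norm _)); apply: ltW; apply: truncnS_gt.
near=> n; apply: (le_trans Mm); rewrite ler_nat; near: n.
exact: (k_infty (nbhs_infty_ge m)).
Unshelve. all: by end_near.
Qed.

Lemma k_small_lt (c : R) : 0 < c -> \forall n \near \oo, c * (k n)%:R < n%:R.
Proof.
move=> c0; near=> n.
have n0 : 0 < n%:R :> R by rewrite ltr0n; near: n; exact: nbhs_infty_gt.
have : `|(k n)%:R / n%:R : R| < c^-1.
  by near: n; apply: (cvgr0_norm_lt _ k_small); rewrite invr_gt0.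
rewrite ger0_norm ?divr_ge0 // ltr_pdivrMr // mulrC ltr_pdivlMr //.
by rewrite mulrC.
Unshelve. all: by end_near.
Qed.

Lemma n_gt0_near : \forall n \near \oo, (0 < n)%N.
Proof. exact: nbhs_infty_gt. Qed.

Lemma expR_log_spacing n : (0 < n)%N -> expR (s n) = n%:R / (k n)%:R.
Proof. by move=> n0; rewrite /log_spacing lnK // posrE divr_gt0 // ltr0n. Qed.

Lemma expR_log_rank n : expR (L n) = (k n)%:R.
Proof. by rewrite /log_rank lnK // posrE. Qed.

Lemma log_spacing_cvgy : s n @[n --> \oo] --> +oo.
Proof.
apply/cvgryPge => M; near=> n.
have n0 : (0 < n)%N by near: n; exact: n_gt0_near.
rewrite -ler_expR expR_log_spacing // ler_pdivlMr //; apply: ltW.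
by near: n; apply: k_small_lt; exact: expR_gt0.
Unshelve. all: by end_near.
Qed.

Lemma log_rank_cvgy : L n @[n --> \oo] --> +oo.
Proof.
apply/cvgryPge => M; near=> n.
by rewrite -ler_expR expR_log_rank; near: n; exact: k_infty_ge.
Unshelve. all: by end_near.
Qed.

Lemma nVexpR n (v : R) : (0 < n)%N -> n%:R / expR (s n + v) = (k n)%:R * expR (- v).
Proof.
move=> n0; rewrite expRD expR_log_spacing // expRN; field.
by rewrite !gt_eqF ?expR_gt0 // ltr0n.
Qed.

(** The expected number of variables above the threshold is at most
    k n * exp (- v n), which leaves a gap of delta n * r n to the rank r n.  By
    the second hypothesis this gap is large compared with sqrt (r n), hence with
    the standard deviation of the number. *)
Lemma whp_order_stat_le (r : nat -> nat) (v delta : nat -> R) :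
  (\forall n \near \oo, [/\ (r n < n)%N, 0 < s n + v n, 0 < delta n
    & (k n)%:R * expR (- v n) <= (r n)%:R * (1 - delta n)]) ->
  (r n)%:R * delta n ^+ 2 @[n --> \oo] --> +oo ->
  whp P (fun n => [set w | order_stat X (n - r n) n w <= W (s n + v n)]).
Proof.
move=> H rd.
apply: (@whpS _ _ _ _ (fun n => ~` [set w | W (s n + v n) < order_stat X (n - r n) n w])); last first.
  by apply: nearW => n w /= /negP; rewrite -leNgt.
apply: (@whp_bound _ _ _ _ _ (fun n => ((r n)%:R * delta n ^+ 2)^-1)).
- move=> n; rewrite (_ : [set w | _] = order_stat X (n - r n) n @^-1` `]W (s n + v n), +oo[).
    by rewrite -[X in measurable X]setTI; apply: measurable_order_stat.
  by apply/seteqP; split=> w /=; rewrite in_itv /= andbT.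
- near=> n.
  have n0 : (0 < n)%N by near: n; exact: n_gt0_near.
  have [rn sv d0 kr] : [/\ (r n < n)%N, 0 < s n + v n, 0 < delta n
    & (k n)%:R * expR (- v n) <= (r n)%:R * (1 - delta n)] by near: n.
  have r0 : 0 < (r n)%:R :> R.
    rewrite lt0r ler0n andbT; apply: contraTneq kr => ->.
    by rewrite mul0r -ltNge mulr_gt0 ?expR_gt0.
  have rd0 : 0 < (r n)%:R * delta n by rewrite mulr_gt0.
  have kr' : (k n)%:R * expR (- v n) <= (r n)%:R - (r n)%:R * delta n.
    by rewrite -[X in _ <= X - _]mulr1 -mulrBr.
  have t1 : 1 < expR (s n + v n) by rewrite expR_gt1.
  have ntr : n%:R / expR (s n + v n) < (r n)%:R by rewrite nVexpR //; lra.
  apply: (le_trans (order_stat_gt_bound X_iid rn t1 ntr)); rewrite nVexpR // lee_fin.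
  apply: (@le_trans _ _ ((r n)%:R / ((r n)%:R * delta n) ^+ 2)).
    apply: ler_pM; first by rewrite mulr_ge0 ?expR_ge0.
    - by rewrite invr_ge0 sqr_ge0.
    - lra.
    - rewrite lef_pV2 ?posrE ?exprn_gt0 //; last lra.
      by rewrite ler_sqr ?nnegrE; lra.
  rewrite le_eqVlt; apply/orP; left; apply/eqP; field.
  by rewrite !gt_eqF.
- by apply/gtr0_cvgV0 => //; near=> n; near: n; exact: (cvgryPgt _).1.
Unshelve. all: by end_near.
Qed.

Lemma whp_order_stat_ge (r : nat -> nat) (v delta : nat -> R) :
  (\forall n \near \oo, [/\ (r n < n)%N, 0 < s n + v n, 0 < delta n <= 1
    & (r n)%:R * (1 + delta n) <= (k n)%:R * expR (- v n)]) ->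
  (r n)%:R * delta n ^+ 2 @[n --> \oo] --> +oo ->
  whp P (fun n => [set w | W (s n + v n) <= order_stat X (n - r n) n w]).
Proof.
move=> H rd.
apply: (@whpS _ _ _ _ (fun n => ~` [set w | order_stat X (n - r n) n w < W (s n + v n)])); last first.
  by apply: nearW => n w /= /negP; rewrite -leNgt.
apply: (@whp_bound _ _ _ _ _ (fun n => 2 * ((r n)%:R * delta n ^+ 2)^-1)).
- move=> n; rewrite (_ : [set w | _] = order_stat X (n - r n) n @^-1` `]-oo, W (s n + v n)[).
    by rewrite -[X in measurable X]setTI; apply: measurable_order_stat.
  by apply/seteqP; split=> w /=; rewrite in_itv.
- near=> n.
  have n0 : (0 < n)%N by near: n; exact: n_gt0_near.
  have [rn sv /andP[d0 d1] kr] : [/\ (r n < n)%N, 0 < s n + v n, 0 < delta n <= 1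
    & (r n)%:R * (1 + delta n) <= (k n)%:R * expR (- v n)] by near: n.
  have r0 : 0 < (r n)%:R :> R.
    have : 1 <= (r n)%:R * delta n ^+ 2 by near: n; exact: (cvgryPge _).1.
    rewrite ltr0n lt0n; apply: contraTneq => ->; rewrite mul0r; lra.
  have rd0 : 0 < (r n)%:R * delta n by rewrite mulr_gt0.
  have kr' : (r n)%:R + (r n)%:R * delta n <= (k n)%:R * expR (- v n).
    by rewrite -[X in X + _ <= _]mulr1 -mulrDr.
  have t1 : 1 < expR (s n + v n) by rewrite expR_gt1.
  have ntr : (r n)%:R < n%:R / expR (s n + v n) by rewrite nVexpR //; lra.
  apply: (le_trans (order_stat_lt_bound X_iid rn t1 ntr)); rewrite nVexpR // lee_fin.
  have r1 : (r n)%:R < (r n)%:R + (r n)%:R * delta n by lra.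
  apply: (le_trans (deviation_ratio_le (ltW r0) r1 kr')).
  rewrite addrAC subrr add0r.
  apply: (@le_trans _ _ ((2 * (r n)%:R) / ((r n)%:R * delta n) ^+ 2)).
    rewrite ler_wpM2r ?invr_ge0 ?sqr_ge0 //.
    have : (r n)%:R * delta n <= (r n)%:R * 1 by rewrite ler_wpM2l // ltW.
    lra.
  rewrite le_eqVlt; apply/orP; left; apply/eqP; field.
  by rewrite !gt_eqF.
- rewrite -[X in _ --> X](mulr0 2); apply: cvgMr.
  by apply/gtr0_cvgV0 => //; near=> n; near: n; exact: (cvgryPgt _).1.
Unshelve. all: by end_near.
Qed.

End Thresholds.

Section Bands.
Context {d : measure_display} {T : measurableType d} {R : realType}.
Variables (P : probability T R) (X : nat -> {RV P >-> R}) (F : R -> R).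
Hypothesis X_iid : iid X F.
Variable k : nat -> nat.
Hypothesis k_gt0 : forall n, (0 < k n)%N.
Hypothesis k_infty : k n @[n --> \oo] --> \oo.
Hypothesis k_small : (k n)%:R / n%:R @[n --> \oo] --> (0 : R).

Local Notation W := (log_quantile F).
Local Notation s := (@log_spacing R k).
Local Notation L := (@log_rank R k).

Let kR0 n : 0 < (k n)%:R :> R. Proof. by rewrite ltr0n. Qed.

Lemma expR_gap (x : R) : 0 <= x <= 2^-1 -> expR (- (2 * x)) <= 1 - x.
Proof.
move=> /andP[x0 x1]; rewrite expRN -[leRHS]invrK lef_pV2 ?posrE ?invr_gt0 ?expR_gt0 //; last lra.
apply: le_trans (expR_ge1Dx (2 * x)).
rewrite invf_ple ?posrE; [|lra|lra].
rewrite -[leLHS]mul1r ler_pdivrMr; last lra.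
have : 0 <= x * (1 - 2 * x) by rewrite mulr_ge0 //; lra.
lra.
Qed.

(** The relative width delta may tend to 0, provided that it is large compared
    with k^(-1/2). *)
Lemma whp_band (q : nat) (delta : nat -> R) : (0 < q)%N ->
  (\forall n \near \oo, 0 < delta n <= 2^-1) ->
  (k n)%:R * delta n ^+ 2 @[n --> \oo] --> +oo ->
  whp P (fun n => [set w |
    W (s n + (- ln q%:R - 2 * delta n)) <= order_stat X (n - q * k n) n w <=
    W (s n + (- ln q%:R + 2 * delta n))]).
Proof.
move=> q0 dP kd.
have q1 : 1 <= q%:R :> R by rewrite ler1n.
have lnq : 0 <= ln q%:R :> R by rewrite ln_ge0.
have qkd : (q * k n)%:R * delta n ^+ 2 @[n --> \oo] --> +oo.
  apply: ger_cvgy kd; apply: nearW => n.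
  by rewrite natrM -mulrA ler_peMl // mulr_ge0 ?sqr_ge0.
have qk n : (k n)%:R * q%:R = (q * k n)%:R :> R by rewrite natrM mulrC.
have eq : expR (ln q%:R) = q%:R :> R by rewrite lnK // posrE ltr0n.
have up : whp P (fun n => [set w | order_stat X (n - q * k n) n w <= W (s n + (- ln q%:R + 2 * delta n))]).
  apply: (whp_order_stat_le X_iid k_gt0
    (r := fun n => (q * k n)%N) (v := fun n => - ln q%:R + 2 * delta n) (delta := delta)) => //.
  near=> n.
  have /andP[d0 d1] : 0 < delta n <= 2^-1 by near: n.
  split => //.
  - by rewrite -(ltr_nat R) natrM; near: n; apply: (k_small_lt k_small) => //; rewrite ltr0n.
  - have : ln q%:R < s n by near: n; exact: (cvgryPgt _).1 (log_spacing_cvgy k_gt0 k_small) _.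
    lra.
  - rewrite -qk -mulrA ler_pM2l // opprD opprK expRD eq ler_pM2l ?ltr0n //.
    by apply: expR_gap; lra.
have lo : whp P (fun n => [set w | W (s n + (- ln q%:R - 2 * delta n)) <= order_stat X (n - q * k n) n w]).
  apply: (whp_order_stat_ge X_iid k_gt0
    (r := fun n => (q * k n)%N) (v := fun n => - ln q%:R - 2 * delta n) (delta := delta)) => //.
  near=> n.
  have /andP[d0 d1] : 0 < delta n <= 2^-1 by near: n.
  split.
  - by rewrite -(ltr_nat R) natrM; near: n; apply: (k_small_lt k_small) => //; rewrite ltr0n.
  - have : ln q%:R + 1 < s n by near: n; exact: (cvgryPgt _).1 (log_spacing_cvgy k_gt0 k_small) _.
    lra.
  - by apply/andP; split; lra.
  - rewrite -qk -mulrA ler_pM2l // opprB opprK [X in expR X]addrC expRD eq ler_pM2l ?ltr0n //.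
    by apply: le_trans (expR_ge1Dx _); lra.
have := whpI lo up; move=> /whpS; apply; apply: nearW => n w /= [h1 h2].
by rewrite h1.
Unshelve. all: by end_near.
Qed.

(** All ranks on one side of k e^y are handled by a single order statistic, that of
    rank n - lo n, since order statistics are monotone in their rank. *)
Lemma whp_grid (y delta : R) : 0 <= y -> 0 < delta ->
  whp P (fun n => [set w | forall r, (r <= 2 * k n)%N ->
    ((k n)%:R * expR y <= r%:R -> order_stat X (n - r) n w <= W (s n + (- y + delta))) /\
    (r%:R <= (k n)%:R * expR y -> W (s n + (- y - delta)) <= order_stat X (n - r) n w)]).
Proof.
move=> y0 d0.
set E := expR (- delta).
have E1 : E < 1 by rewrite expR_lt1 oppr_lt0.
have E0 : 0 < E by exact: expR_gt0.
(* Half of the available relative gap; the other half absorbs the rounding of x n. *)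
pose e := (1 - E) / 2.
have e0 : 0 < e by rewrite divr_gt0 // subr_gt0.
have e1 : e <= 1 by rewrite /e; lra.
have e3 : 1 + e <= expR delta.
  apply: le_trans (expR_ge1Dx _).
  by have := expR_ge1Dx (- delta); rewrite -/E /e; lra.
pose x n := (k n)%:R * expR y.
have x1 n : 1 <= x n.
  rewrite /x -[leLHS]mulr1; apply: ler_pM => //; first by rewrite ler1n.
  by rewrite -expR0 ler_expR.
pose lo n := Num.truncn (x n).
have loP n : (lo n)%:R <= x n /\ x n < (lo n)%:R + 1.
  have xn0 : 0 <= x n by apply: le_trans (x1 n).
  by have /andP[] := truncn_itv xn0; rewrite -[X in _ < X]natr1; split.
have x_y : x n @[n --> \oo] --> +oo.
  apply/cvgryPge => M; near=> n; apply: (@le_trans _ _ (k n)%:R).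
    by near: n; exact: (k_infty_ge k_infty).
  by rewrite /x ler_peMr // -expR0 ler_expR.
have x_small : \forall n \near \oo, x n + 1 < n%:R.
  near=> n; have : expR y * 2 * (k n)%:R < n%:R.
    by near: n; apply: (k_small_lt k_small) => //; rewrite mulr_gt0 ?expR_gt0.
  by have := x1 n; rewrite {2}/x; have : expR y * 2 * (k n)%:R = 2 * x n by [rewrite /x; ring]; lra.
have k2_small : \forall n \near \oo, (2 * k n < n)%N.
  by near=> n; rewrite -(ltr_nat R) natrM; near: n; apply: (k_small_lt k_small).
have s_large (M : R) : \forall n \near \oo, M < s n.
  exact: ((cvgryPgt _).1 (log_spacing_cvgy k_gt0 k_small) M).
have lo_n : \forall n \near \oo, (lo n < n)%N.
  near=> n; have [lo1 _] := loP n; rewrite -(ltr_nat R).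
  have : x n + 1 < n%:R by near: n.
  lra.
have lo_y : (lo n)%:R * e ^+ 2 @[n --> \oo] --> +oo.
  apply: (@ger_cvgy _ _ _ _ (fun n => e ^+ 2 / 2 * x n)).
    near=> n; have [_ lo2] := loP n.
    have x2 : 2 <= x n by near: n; exact: (cvgryPge _).1.
    rewrite mulrAC -mulrA mulrC ler_wpM2r ?sqr_ge0 //; lra.
  apply/cvgryPge => M; near=> n; rewrite mulrC -ler_pdivrMr ?divr_gt0 ?exprn_gt0 //.
  by near: n; exact: (cvgryPge _).1.
have up : whp P (fun n => [set w | order_stat X (n - lo n) n w <= W (s n + (- y + delta))]).
  apply: (whp_order_stat_le X_iid k_gt0
    (r := lo) (v := fun=> - y + delta) (delta := fun=> e)) => //.
  near=> n; split => //.
  - by near: n.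
  - have : y < s n by near: n.
    lra.
  - rewrite opprD opprK expRD mulrA -/(x n) -/E; have [_ lo2] := loP n.
    have x2 : 2 / (1 - E) <= x n by near: n; exact: (cvgryPge _).1.
    rewrite ler_pdivrMr ?subr_gt0 // in x2.
    apply: (@le_trans _ _ ((x n - 1) * (1 - e))); last by rewrite ler_wpM2r; rewrite /e; lra.
    by rewrite /e; lra.
have dn : whp P (fun n => [set w | W (s n + (- y - delta)) <= order_stat X (n - lo n) n w]).
  apply: (whp_order_stat_ge X_iid k_gt0
    (r := lo) (v := fun=> - y - delta) (delta := fun=> e)) => //.
  near=> n; split => //.
  - by near: n.
  - have : y + delta < s n by near: n.
    lra.
  - by rewrite e0.
  - rewrite opprB opprK [X in expR X]addrC expRD mulrA -/(x n); have [lo1 _] := loP n.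
    by apply: ler_pM => //; lra.
have := whpI (whp_near P k2_small) (whpI (whp_near P lo_n) (whpI up dn)).
move=> /whpS; apply; apply: nearW => n w /= [kn [lon [h1 h2]]] r r2k.
have rn : (r < n)%N by exact: leq_ltn_trans kn.
have [lo1 lo2] := loP n; split => hr.
- apply: le_trans h1; apply: order_stat_anti => //.
  by rewrite -(ler_nat R) (le_trans lo1).
- apply: (le_trans h2); apply: order_stat_anti => //.
  by rewrite -ltnS -(ltr_nat R) -natr1; apply: le_lt_trans lo2.
Unshelve. all: by end_near.
Qed.

End Bands.

Section ProfileAndMaximum.
Context {d : measure_display} {T : measurableType d} {R : realType}.
Variables (P : probability T R) (X : nat -> {RV P >-> R}) (F : R -> R).
Hypothesis X_iid : iid X F.
Variable k : nat -> nat.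
Hypothesis k_gt0 : forall n, (0 < k n)%N.
Hypothesis k_infty : k n @[n --> \oo] --> \oo.
Hypothesis k_small : (k n)%:R / n%:R @[n --> \oo] --> (0 : R).

Local Notation W := (log_quantile F).
Local Notation s := (@log_spacing R k).
Local Notation L := (@log_rank R k).

Let kR0 n : 0 < (k n)%:R :> R. Proof. by rewrite ltr0n. Qed.

(** Uniformity in r comes from a fixed finite grid of mesh delta on the scale
    log (r / k) and from monotonicity in between. *)
Lemma whp_profile (delta : R) : 0 < delta ->
  whp P (fun n => [set w | forall r, (k n <= r <= 2 * k n)%N ->
    W (s n + (- ln (r%:R / (k n)%:R) - 2 * delta)) <= order_stat X (n - r) n w <=
    W (s n + (- ln (r%:R / (k n)%:R) + 2 * delta))]).
Proof.
move=> d0.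
(* The grid covers [0, 1], which contains ln 2, and has one more point. *)
pose m := (Num.truncn (delta^-1)).+2.
have grid j : (j < m)%N -> whp P (fun n => [set w | forall r, (r <= 2 * k n)%N ->
    ((k n)%:R * expR (j%:R * delta) <= r%:R -> order_stat X (n - r) n w <= W (s n + (- (j%:R * delta) + delta))) /\
    (r%:R <= (k n)%:R * expR (j%:R * delta) -> W (s n + (- (j%:R * delta) - delta)) <= order_stat X (n - r) n w)]).
  by move=> _; apply: (whp_grid X_iid k_gt0 k_infty k_small) => //; rewrite mulr_ge0 // ltW.
have s_large : \forall n \near \oo, 1 + 4 * delta < s n.
  exact: ((cvgryPgt _).1 (log_spacing_cvgy k_gt0 k_small)).
have := whpI (whp_near P s_large) (whp_forall grid).
move=> /whpS; apply; apply: nearW => n w /= [sn Hj] r /andP[kr r2k].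
have rR : 0 < r%:R :> R by rewrite ltr0n (leq_trans _ kr).
set y := ln (r%:R / (k n)%:R).
have ey : (k n)%:R * expR y = r%:R.
  by rewrite /y lnK ?posrE ?divr_gt0 // mulrC divfK // gt_eqF.
have y0 : 0 <= y by apply: ln_ge0; rewrite ler_pdivlMr // mul1r ler_nat.
have y1 : y <= 1.
  apply: le_trans (ltW (ln2_lt1 R)); rewrite /y ler_ln ?posrE ?divr_gt0 //.
  by rewrite ler_pdivrMr // -natrM ler_nat.
pose j := Num.truncn (y / delta).
have [j1 j2] : j%:R * delta <= y /\ y < j.+1%:R * delta.
  have yd0 : 0 <= y / delta by rewrite divr_ge0 // ltW.
  have /andP[h1 h2] := truncn_itv yd0; split; first by rewrite -ler_pdivlMr.
  by rewrite -ltr_pdivrMr.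
have jm : (j.+1 < m)%N.
  rewrite /m ltnS ltnS; apply: le_truncn; rewrite -[leRHS]mul1r ler_wpM2r //.
  by rewrite invr_ge0 ltW.
have [up _] := Hj j (ltnW jm) r r2k.
have [_ lo] := Hj j.+1 jm r r2k.
have j3 : j.+1%:R * delta = j%:R * delta + delta by rewrite -natr1 mulrDl mul1r.
have jd0 : 0 <= j%:R * delta by rewrite mulr_ge0 // ltW.
rewrite j3 in j2 lo.
apply/andP; split.
- apply: (le_trans _ (lo _)); last by rewrite -ey ler_pM2l // ler_expR ltW.
  by apply: (log_quantile_homo X_iid); rewrite ?in_itv /= ?andbT; lra.
- apply: (le_trans (up _)); first by rewrite -ey ler_pM2l // ler_expR.
  by apply: (log_quantile_homo X_iid); rewrite ?in_itv /= ?andbT; lra.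
Qed.

Lemma expR_log_size n (x : R) : (0 < n)%N -> expR (s n + (L n + x)) = n%:R * expR x.
Proof.
move=> n0; rewrite !expRD expR_log_spacing // expR_log_rank //; field.
by rewrite gt_eqF.
Qed.

Lemma n_expR_gt (x M : R) : \forall n \near \oo, M < n%:R * expR x.
Proof.
near=> n; rewrite -ltr_pdivrMr ?expR_gt0 //.
by near: n; exact: nbhs_infty_gtr.
Unshelve. all: by end_near.
Qed.

(** (1 - y/n)^n is at least exp (- y / (1 - y/n)), which tends to e^(-y); here
    y = e^(-x). *)
Lemma prob_max_le_limit (x e : R) : 0 < e -> \forall n \near \oo,
  ((gumbel_cdf x - e)%:E <= P [set w | (order_stat X n n w <= W (s n + (L n + x)))%R])%E.
Proof.
move=> e0; pose y := expR (- x).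
have y0 : 0 < y by exact: expR_gt0.
have cv : expR (- (y / (1 - y / n%:R))) @[n --> \oo] --> gumbel_cdf x.
  have -> : gumbel_cdf x = expR (- (y / (1 - y * 0))) by rewrite mulr0 subr0 divr1.
  apply: (@cvg_comp _ _ _ (fun n : nat => - (y / (1 - y / n%:R))) expR _ _ _ _ (@continuous_expR R _)).
  apply: cvgN; apply: cvgMr; apply: cvgV; first by rewrite mulr0 subr0.
  apply: cvgB; first exact: cvg_cst.
  apply: cvgMr; apply/gtr0_cvgV0; last exact: cvgr_idn.
  by near=> n; rewrite ltr0n; near: n; exact: nbhs_infty_gt.
near=> n.
have n0 : (0 < n)%N by near: n; exact: nbhs_infty_gt.
have nR0 : 0 < n%:R :> R by rewrite ltr0n.
have t1 : 1 < n%:R * expR x by near: n; exact: n_expR_gt.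
rewrite /log_quantile expR_log_size //.
apply: le_trans (prob_max_le X_iid n0 t1).
have -> : (n%:R * expR x)^-1 = y / n%:R by rewrite invfM mulrC /y expRN.
have z1 : y / n%:R < 1.
  rewrite ltr_pdivrMr // mul1r /y expRN -[ltLHS]mul1r ltr_pdivrMr ?expR_gt0 //.
rewrite lee_fin.
apply: (@le_trans _ _ (expR (- (y / (1 - y / n%:R))))).
  have : `|gumbel_cdf x - expR (- (y / (1 - y / n%:R)))| <= e.
    by near: n; exact: (cvgr_dist_le _ _ cv).
  by rewrite ler_norml => /andP[_]; lra.
have z10 : 1 - y / n%:R != 0 by rewrite gt_eqF // subr_gt0.
have -> : - (y / (1 - y / n%:R)) = n%:R * (- (y / n%:R / (1 - y / n%:R))).
  by rewrite mulrN !mulrA [n%:R * y]mulrC mulfK // gt_eqF.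
rewrite expRM_natl; apply: lerXn2r; rewrite ?nnegrE ?expR_ge0 //.
  by rewrite subr_ge0 ltW.
rewrite expRN -[leRHS]invrK lef_pV2 ?posrE ?invr_gt0 ?expR_gt0 ?subr_gt0 //.
apply: le_trans (expR_ge1Dx _).
move: (y / n%:R) z10 => z z10.
by have -> : 1 + z / (1 - z) = (1 - z)^-1 by field.
Unshelve. all: by end_near.
Qed.

(** (1 - y/n)^n <= e^(-y). *)
Lemma prob_max_lt_limit (x : R) : \forall n \near \oo,
  (P [set w | (order_stat X n n w < W (s n + (L n + x)))%R] <= (gumbel_cdf x)%:E)%E.
Proof.
pose y := expR (- x).
near=> n.
have n0 : (0 < n)%N by near: n; exact: nbhs_infty_gt.
have nR0 : 0 < n%:R :> R by rewrite ltr0n.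
have t1 : 1 < n%:R * expR x by near: n; exact: n_expR_gt.
rewrite /log_quantile expR_log_size //.
apply: (le_trans (prob_max_lt X_iid n0 t1)).
have -> : (n%:R * expR x)^-1 = y / n%:R by rewrite invfM mulrC /y expRN.
rewrite lee_fin /gumbel_cdf -/y.
have -> : - y = n%:R * (- (y / n%:R)) by field; rewrite gt_eqF.
rewrite expRM_natl; apply: lerXn2r; rewrite ?nnegrE ?expR_ge0 //.
  rewrite subr_ge0 ler_pdivrMr // mul1r /y expRN -[leLHS]mul1r ler_pdivrMr ?expR_gt0 //.
  exact: ltW.
exact: expR_ge1Dx.
Unshelve. all: by end_near.
Qed.

Lemma measurable_order_stat_max_le n x : measurable [set w | order_stat X n n w <= x].
Proof.
rewrite (_ : [set w | _] = order_stat X (n - 0) n @^-1` `]-oo, x]).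
  by rewrite -[X in measurable X]setTI; apply: measurable_order_stat.
by apply/seteqP; split=> w /=; rewrite in_itv /= subn0.
Qed.

Lemma measurable_order_stat_max_lt n x : measurable [set w | order_stat X n n w < x].
Proof.
rewrite (_ : [set w | _] = order_stat X (n - 0) n @^-1` `]-oo, x[).
  by rewrite -[X in measurable X]setTI; apply: measurable_order_stat.
by apply/seteqP; split=> w /=; rewrite in_itv /= subn0.
Qed.

Lemma bad_prob_small (B : nat -> set T) (e : R) : 0 < e -> P (B n) @[n --> \oo] --> 0%E ->
  \forall n \near \oo, (P (B n) <= e%:E)%E.
Proof.
move=> e0 /fine_cvgP[fB cB]; near=> n.
rewrite -(@fineK _ (P (B n))); last by near: n.
rewrite lee_fin; apply: le_trans (ler_norm _) _.
by near: n; exact: (cvgr0_norm_le _ cB).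
Unshelve. all: by end_near.
Qed.

(** The form in which limits are taken: on likely events, E is compared with an
    event that concerns the maximum alone. *)
Lemma prob_ge_gumbel (A E : nat -> set T) (x e : R) : (forall n, measurable (E n)) ->
  whp P A ->
  (\forall n \near \oo, forall w, A n w -> order_stat X n n w <= W (s n + (L n + x)) -> E n w) ->
  0 < e -> \forall n \near \oo, ((gumbel_cdf x - e)%:E <= P (E n))%E.
Proof.
move=> mE [B [mB PB BA]] AE e0; have e20 : 0 < e / 2 by rewrite divr_gt0.
near=> n.
have h1 : (P (B n) <= (e / 2)%:E)%E by near: n; exact: bad_prob_small.
have h2 : ((gumbel_cdf x - e / 2)%:E <= P [set w | (order_stat X n n w <= W (s n + (L n + x)))%R])%E.
  by near: n; exact: prob_max_le_limit.
have h3 : (P [set w | (order_stat X n n w <= W (s n + (L n + x)))%R] <= P (E n) + P (B n))%E.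
  apply: le_trans (measureU2 _ (mE n) (mB n)); apply: le_measure; rewrite ?inE.
  - exact: measurable_order_stat_max_le.
  - exact: measurableU.
  - have BAn : ~` B n `<=` A n by near: n.
    have AEn : forall w, A n w -> order_stat X n n w <= W (s n + (L n + x)) -> E n w by near: n.
    move=> w /= Mw; have [Bw|nBw] := pselect (B n w); first by right.
    by left; apply: AEn => //; exact: BAn.
have := le_trans h2 (le_trans h3 (leeD2l (P (E n)) h1)).
have fE : P (E n) \is a fin_num by apply: fin_num_measure; exact: mE.
by rewrite -(fineK fE) -EFinD !lee_fin; lra.
Unshelve. all: by end_near.
Qed.

Lemma prob_le_gumbel (A E : nat -> set T) (x e : R) : (forall n, measurable (E n)) ->
  whp P A ->
  (\forall n \near \oo, forall w, A n w -> E n w -> order_stat X n n w < W (s n + (L n + x))) ->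
  0 < e -> \forall n \near \oo, (P (E n) <= (gumbel_cdf x + e)%:E)%E.
Proof.
move=> mE [B [mB PB BA]] AE e0.
near=> n.
have h1 : (P (B n) <= e%:E)%E by near: n; exact: bad_prob_small.
have h2 : (P [set w | (order_stat X n n w < W (s n + (L n + x)))%R] <= (gumbel_cdf x)%:E)%E.
  by near: n; exact: prob_max_lt_limit.
rewrite EFinD; apply: le_trans (leeD h2 h1).
apply: le_trans (measureU2 _ (measurable_order_stat_max_lt _ _) (mB n)); apply: le_measure; rewrite ?inE.
- exact: mE.
- by apply: measurableU => //; exact: measurable_order_stat_max_lt.
- have BAn : ~` B n `<=` A n by near: n.
  have AEn : forall w, A n w -> E n w -> order_stat X n n w < W (s n + (L n + x)) by near: n.
  move=> w Ew; have [Bw|nBw] := pselect (B n w); first by right.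
  by left; apply: AEn => //; exact: BAn.
Unshelve. all: by end_near.
Qed.

End ProfileAndMaximum.

(** * Limits of the statistic *)

Section Endpoint.
Context {d : measure_display} {T : measurableType d} {R : realType}.
Variables (P : probability T R) (X : nat -> {RV P >-> R}) (F : R -> R).
Hypothesis X_iid : iid X F.
Variable k : nat -> nat.
Hypothesis k_gt0 : forall n, (0 < k n)%N.
Hypothesis k_infty : k n @[n --> \oo] --> \oo.
Hypothesis k_small : (k n)%:R / n%:R @[n --> \oo] --> (0 : R).

Local Notation W := (log_quantile F).
Local Notation s := (@log_spacing R k).
Local Notation L := (@log_rank R k).
Local Notation os r n w := (order_stat X (n - r) n w).
Local Notation G n w := (G_star0 X n (k n) w).

Lemma measurable_G_le n x : measurable [set w | G n w <= x].
Proof.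
rewrite (_ : [set w | _] = (fun w => G n w) @^-1` `]-oo, x]).
  by rewrite -[Y in measurable Y]setTI; apply: measurable_G_star0.
by apply/seteqP; split=> w /=; rewrite in_itv.
Qed.

Lemma measurable_G_lt n x : measurable [set w | G n w < x].
Proof.
rewrite (_ : [set w | _] = (fun w => G n w) @^-1` `]-oo, x[).
  by rewrite -[Y in measurable Y]setTI; apply: measurable_G_star0.
by apply/seteqP; split=> w /=; rewrite in_itv.
Qed.

Lemma measurable_G_gt n x : measurable [set w | x < G n w].
Proof.
rewrite (_ : [set w | _] = (fun w => G n w) @^-1` `]x, +oo[).
  by rewrite -[Y in measurable Y]setTI; apply: measurable_G_star0.
by apply/seteqP; split=> w /=; rewrite in_itv /= andbT.
Qed.

Lemma near_two_k_lt : \forall n \near \oo, (2 * k n < n)%N.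
Proof.
near=> n; rewrite -(ltr_nat R) natrM; near: n; exact: (k_small_lt k_small).
Unshelve. all: by end_near.
Qed.

Lemma near_log_rank_gt (M : R) : \forall n \near \oo, M < L n.
Proof. exact: ((cvgryPgt _).1 (log_rank_cvgy k_gt0 k_infty) M). Qed.

Lemma near_log_spacing (Q : R -> Prop) : (\forall x \near +oo, Q x) -> \forall n \near \oo, Q (s n).
Proof. by move=> HQ; exact: (log_spacing_cvgy k_gt0 k_small HQ). Qed.

(** All the order statistics that occur lie between those of ranks n - 2k and
    n - k. *)
Lemma lower_spread_itv n w : (2 * k n < n)%N ->
  0 <= lower_spread X n (k n) w <= ln 2 * (os (k n) n w - os (2 * k n) n w).
Proof.
move=> kn; rewrite -(sum_weight R (k_gt0 n)) mulr_suml; apply/andP; split.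
  rewrite /lower_spread big_nat; apply: sumr_ge0 => i /andP[_ ik].
  rewrite mulr_ge0 ?weight_ge0 // subr_ge0 order_stat_anti ?leq_addr //.
  by apply: leq_trans kn; rewrite ltnS mul2n -addnn leq_add2l ltnW.
apply: ler_sum_nat => i /andP[_ ik].
rewrite ler_wpM2l ?weight_ge0 // lerB // order_stat_anti //.
by rewrite mul2n -addnn leq_add2l ltnW.
Qed.

Let delta n : R := expR (- (L n / 4)).

Lemma expR_log_rank_small (e : R) : 0 < e -> \forall n \near \oo, delta n < e.
Proof.
move=> e0; near=> n; rewrite /delta expRN invf_plt ?posrE ?expR_gt0 //.
apply: lt_le_trans (expR_ge1Dx _).
have : 4 * e^-1 < L n by near: n; exact: near_log_rank_gt.
lra.
Unshelve. all: by end_near.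
Qed.

(** The width k^(-1/4) is large compared with k^(-1/2) and small compared with
    1 / log k. *)
Lemma whp_two_bands : whp P (fun n => [set w |
  W (s n - 2 * delta n) <= os (k n) n w <= W (s n + 2 * delta n) /\
  W (s n + (- ln 2 - 2 * delta n)) <= os (2 * k n) n w <= W (s n + (- ln 2 + 2 * delta n))]).
Proof.
have d1 : \forall n \near \oo, 0 < delta n <= 2^-1.
  near=> n; rewrite expR_gt0 /=; apply: ltW; near: n; exact: expR_log_rank_small.
have d2 : (k n)%:R * delta n ^+ 2 @[n --> \oo] --> +oo.
  apply/cvgryPge => M; near=> n.
  have -> : (k n)%:R * delta n ^+ 2 = expR (L n / 2).
    by rewrite -(@expR_log_rank R _ k_gt0 n) /delta -expRM_natl -expRD; congr expR; field.
  apply: le_trans (expR_ge1Dx _).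
  have : 2 * M < L n by near: n; exact: near_log_rank_gt.
  lra.
have b1 := whp_band X_iid k_gt0 k_small (q := 1) isT d1 d2.
have b2 := whp_band X_iid k_gt0 k_small (q := 2) isT d1 d2.
have := whpI b1 b2; move=> /whpS; apply; apply: nearW => n w /=.
by rewrite ln1 oppr0 sub0r add0r mul1n.
Unshelve. all: by end_near.
Qed.

Section NonzeroIndex.
Variables (gamma : R) (a : R -> R).
Hypothesis gamma_neq0 : gamma != 0.
Hypothesis U_first : first_order (tail_quantile F) gamma a.

Let W_first u : (W (x + u) - W x) / a (expR x) @[x --> +oo] --> (expR (gamma * u) - 1) / gamma.
Proof.
have [_ _ /(_ _ (expR_gt0 u))] := U_first.
rewrite box_cox_expR // => /cvg_expR.
by under eq_fun do rewrite -expRD.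
Qed.

Let a_gt0 : \forall x \near +oo, 0 < a (expR x).
Proof.
have [a0 _ _] := U_first; near=> x; apply: a0; rewrite expR_gt1.
by near: x; exact: nbhs_pinfty_gt.
Unshelve. all: by end_near.
Qed.

Let l4 : R := ln 2 / 4.

(** The margins ln 2 / 4 keep the two order statistics on either side of a
    deterministic gap, so that the denominator of G_stat is positive. *)
Lemma whp_spacing : whp P (fun n => [set w |
  [/\ W (s n - l4) <= os (k n) n w, os (k n) n w <= W (s n + 1),
      W (s n - 1) <= os (2 * k n) n w, os (2 * k n) n w <= W (s n - 3 * l4)
    & W (s n - 3 * l4) < W (s n - l4)]]).
Proof.
have l2 := ln2_lt1 R; have l2' := ln2_ge_half R.
have e0 : 0 < l4 / 2 by rewrite /l4; lra.
have e1 : 0 < (1 - ln 2) / 2 :> R by lra.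
have near_n : \forall n \near \oo, [/\ W (s n - l4) <= W (s n - 2 * delta n),
    W (s n + 2 * delta n) <= W (s n + 1), W (s n - 1) <= W (s n + (- ln 2 - 2 * delta n)),
    W (s n + (- ln 2 + 2 * delta n)) <= W (s n - 3 * l4) & W (s n - 3 * l4) < W (s n - l4)].
  have u12 : - (3 * l4) < - l4 by rewrite /l4; lra.
  have inc := near_log_spacing (first_order_increasing gamma_neq0 a_gt0 W_first u12).
  near=> n.
  have d0 : 0 < delta n by exact: expR_gt0.
  have d1 : delta n < l4 / 2 by near: n; exact: expR_log_rank_small.
  have d2 : delta n < (1 - ln 2) / 2 by near: n; exact: expR_log_rank_small.
  have sn : 2 < s n by near: n; exact: (near_log_spacing (nbhs_pinfty_gt (num_real 2))).
  have ll : ln 2 = 4 * l4 by rewrite /l4; field.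
  have mono x y : -2 <= x -> x <= y -> W (s n + x) <= W (s n + y).
    by move=> x2 xy; apply: (log_quantile_homo X_iid); rewrite ?in_itv /= ?andbT ?lerD2l //; lra.
  have j1 : - l4 <= - (2 * delta n) by lra.
  have j2 : 2 * delta n <= 1 by lra.
  have j3 : - 1 <= - ln 2 - 2 * delta n by lra.
  have j4 : - ln 2 + 2 * delta n <= - (3 * l4) by lra.
  have j5 : - 2 <= - l4 by lra.
  have j6 : - 2 <= 2 * delta n by lra.
  have j7 : - 2 <= - 1 :> R by lra.
  have j8 : - 2 <= - ln 2 + 2 * delta n by lra.
  split; [exact: mono|exact: mono|exact: mono|exact: mono|].
  by near: n.
have := whpI (whp_near P near_n) whp_two_bands; move=> /whpS; apply; apply: nearW => n w /=.
move=> [[m1 m2 m3 m4 inc] [/andP[h1 h2] /andP[h3 h4]]].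
split; [exact: le_trans h1|exact: (le_trans h2)|exact: le_trans h3|exact: (le_trans h4)|exact: inc].
Unshelve. all: by end_near.
Qed.

(** The maximum exceeds U (n e^x) with probability near 1 for very negative x, and
    then the ratio is at least of order log k. *)
Lemma G_star0_pinfty : 0 < gamma ->
  cvg_in_probability_pinfty P (fun n w => G n w).
Proof.
move=> g0 M0; apply: cvg_prob1; first by move=> n; exact: measurable_G_gt.
move=> e e0; have e20 : 0 < e / 2 by rewrite divr_gt0.
have [x Lx] := gumbel_small e20.
have near_n : \forall n \near \oo, [/\ (2 * k n < n)%N, `|M0| + 1 < L n &
    4 * L n * (W (s n + 1) - W (s n - 1)) <= W (s n + (L n + x)) - W (s n + 1)].
  near=> n; split; near: n.
  - exact: near_two_k_lt.
  - exact: near_log_rank_gt.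
  - apply: (far_increment_large gamma_neq0 (log_quantile_homo X_iid) a_gt0 W_first) => //.
      exact: log_spacing_cvgy.
    exact: log_rank_cvgy.
have HE : \forall n \near \oo, (P [set w | (G n w <= M0)%R] <= (gumbel_cdf x + e / 2)%:E)%E.
  apply: (prob_le_gumbel X_iid k_gt0 (E := fun n => [set w | G n w <= M0]) _
    (whpI (whp_near P near_n) whp_spacing) _ e20).
    by move=> n; exact: measurable_G_le.
  apply: nearW => n w /= [[kn Ln far] [h1 h2 h3 h4 h5]].
  (* If the maximum is not below the threshold, the statistic exceeds M0. *)
  rewrite [X in _ -> is_true X]ltNge; apply: contraTN => Mx.
  have /andP[S0 _] := lower_spread_itv w kn.
  rewrite -ltNge G_star0E // -/(L n).
  apply: (ratio_large (ln2_ge_half R) (ltW (ln2_lt1 R)) Ln _ S0 far h2 h3 Mx).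
  by rewrite subr_gt0; apply: (le_lt_trans h4); apply: (lt_le_trans h5).
near=> n.
have -> : [set w | M0 < G n w] = ~` [set w | G n w <= M0].
  by apply/seteqP; split=> w /=; rewrite ltNge => /negP.
rewrite probability_setC; last exact: measurable_G_le.
have fE : P [set w | G n w <= M0] \is a fin_num by apply: fin_num_measure; exact: measurable_G_le.
have : (P [set w | (G n w <= M0)%R] <= (gumbel_cdf x + e / 2)%:E)%E by near: n.
by rewrite -(fineK fE) -EFinB !lee_fin; lra.
Unshelve. all: by end_near.
Qed.

(** The maximum is below U (n e^x) with probability near 1 for large x, and then the
    ratio is bounded, while log k is subtracted. *)
Lemma G_star0_ninfty : gamma < 0 ->
  cvg_in_probability_ninfty P (fun n w => G n w).
Proof.
move=> g0 M0; apply: cvg_prob1; first by move=> n; exact: measurable_G_lt.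
move=> e e0; have e20 : 0 < e / 2 by rewrite divr_gt0.
have [x Lx] := gumbel_large e20.
have l2 := ln2_lt1 R; have l2' := ln2_ge_half R.
have v12 : l4 < 3 * l4 by rewrite /l4; lra.
have [K HK] := far_increment_small gamma_neq0 (log_quantile_homo X_iid) a_gt0 W_first g0 v12.
have near_n : \forall n \near \oo, [/\ (2 * k n < n)%N, `|M0| + Num.max K 0 + 1 < L n &
    W (s n + (L n + x)) - W (s n - l4) <= K * (W (s n - l4) - W (s n - 3 * l4))].
  near=> n; split; near: n.
  - exact: near_two_k_lt.
  - exact: near_log_rank_gt.
  - apply: HK; [exact: log_spacing_cvgy|exact: log_rank_cvgy].
have HE : \forall n \near \oo, ((gumbel_cdf x - e / 2)%:E <= P [set w | (G n w < - M0)%R])%E.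
  apply: (prob_ge_gumbel X_iid k_gt0 (E := fun n => [set w | G n w < - M0]) _
    (whpI (whp_near P near_n) whp_spacing) _ e20).
    by move=> n; exact: measurable_G_lt.
  apply: nearW => n w /= [[kn Ln far] [h1 h2 h3 h4 h5]] Mx.
  have /andP[_ SD] := lower_spread_itv w kn.
  rewrite G_star0E // -/(L n).
  have l01 : 0 <= (ln 2 : R) <= 1 by rewrite (ltW (ln2_lt1 R)) andbT ln_ge0 // ler1n.
  exact: (ratio_small l01 Ln h5 SD far h1 h4 Mx).
near=> n.
have : ((gumbel_cdf x - e / 2)%:E <= P [set w | (G n w < - M0)%R])%E by near: n.
by apply: le_trans; rewrite lee_fin; lra.
Unshelve. all: by end_near.
Qed.

End NonzeroIndex.

End Endpoint.

Section Gumbel.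
Context {d : measure_display} {T : measurableType d} {R : realType}.
Variables (P : probability T R) (X : nat -> {RV P >-> R}) (F : R -> R).
Hypothesis X_iid : iid X F.
Variable k : nat -> nat.
Hypothesis k_gt0 : forall n, (0 < k n)%N.
Hypothesis k_infty : k n @[n --> \oo] --> \oo.
Hypothesis k_small : (k n)%:R / n%:R @[n --> \oo] --> (0 : R).
Variables (a A0 : R -> R) (rho lambda : R).
Hypothesis rho_le0 : rho <= 0.
Hypothesis a_gt0 : forall t, 1 < t -> 0 < a t.
Hypothesis SO : second_order (tail_quantile F) 0 rho a A0.
Hypothesis k_A0 : Num.sqrt (k n)%:R * A0 (n%:R / (k n)%:R) @[n --> \oo] --> lambda.

Local Notation W := (log_quantile F).
Local Notation s := (@log_spacing R k).
Local Notation L := (@log_rank R k).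
Local Notation os r n w := (order_stat X (n - r) n w).
Local Notation G n w := (G_star0 X n (k n) w).
Let alpha (x : R) : R := scale0 0 rho a A0 (expR x).
Let beta (x : R) : R := `|A0 (expR x)|.

Lemma scaled_increments : exists2 K : R, 0 < K & \forall x \near +oo,
  forall v, `|v| <= 1 ->
  [/\ `|W (x + v) - W x - alpha x * v| <= K * (alpha x * beta x),
      `|alpha (x + v) - alpha x| <= K * (alpha x * beta x)
    & beta (x + v) <= K * beta x].
Proof.
apply: (@uniform_increments R W alpha beta (expR (3 * rho) / 2) 5).
- exact: (log_quantile_homo X_iid).
- exact: (measurable_beta SO).
- by rewrite divr_gt0 // expR_gt0.
- by [].
- exact: (alpha_gt0 a_gt0 SO).
- exact: (beta_gt0 SO).
- exact: (beta_cvg0 SO).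
- by move=> u u03; apply: (second_order_step rho_le0 a_gt0 SO).
Qed.

(** As e^(L/2) = sqrt k, this is the boundedness of sqrt k * A0 (n / k). *)
Lemma beta_bound : \forall n \near \oo, beta (s n) * expR (L n / 2) <= `|lambda| + 1.
Proof.
near=> n; have n0 : (0 < n)%N by near: n; exact: nbhs_infty_gt.
have -> : expR (L n / 2) = Num.sqrt (k n)%:R.
  rewrite -(@expR_log_rank R _ k_gt0 n) -[LHS]ger0_norm ?expR_ge0 // -sqrtr_sqr.
  by rewrite -expRM_natl; congr (Num.sqrt (expR _)); field.
rewrite /beta expR_log_spacing // mulrC -{1}(@ger0_norm _ (Num.sqrt _)) ?sqrtr_ge0 // -normrM.
apply: ltW; near: n; apply: (cvgr_norm_lt _ k_A0); lra.
Unshelve. all: by end_near.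
Qed.

(** Any rate o(1 / log k) suffices in what follows, and C / (log k)^2 is one. *)
Lemma increment_error_bound (K : R) : 0 < K -> exists2 C : R, 0 < C &
  \forall n \near \oo, 2 * expR (- (L n / 4)) + K * beta (s n) <= C / L n ^+ 2.
Proof.
move=> K0; exists (32 * (2 + K * (`|lambda| + 1))).
  have := normr_ge0 lambda => l0; rewrite mulr_gt0 // addr_gt0 // mulr_gt0 //; lra.
near=> n.
have L0 : 0 < L n by near: n; exact: (near_log_rank_gt k_gt0 k_infty).
have hd : expR (- (L n / 4)) <= 32 / L n ^+ 2.
  have l4 : 0 <= L n / 4 by rewrite divr_ge0 // ltW.
  have := expR_ge1Dxn 1 l4; have -> : (2`!)%:R = 2 :> R by [].
  move=> h; rewrite expRN -[leRHS]invrK lef_pV2 ?posrE ?expR_gt0 ?invr_gt0 ?divr_gt0 ?exprn_gt0 //.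
  apply: le_trans h; have -> : (32 / L n ^+ 2)^-1 = (L n / 4) ^+ 2 / 2 by field; rewrite gt_eqF.
  by rewrite lerDr.
have hb : beta (s n) <= (`|lambda| + 1) * expR (- (L n / 4)).
  have hb0 : beta (s n) * expR (L n / 2) <= `|lambda| + 1 by near: n; exact: beta_bound.
  rewrite expRN ler_pdivlMr ?expR_gt0 //; apply: le_trans hb0.
  rewrite ler_wpM2l ?normr_ge0 // ler_expR ler_wpM2l ?(ltW L0) // lef_pV2 ?posrE //; lra.
have : K * beta (s n) <= K * ((`|lambda| + 1) * expR (- (L n / 4))) by rewrite ler_pM2l.
have l0 := normr_ge0 lambda.
have : (2 + K * (`|lambda| + 1)) * expR (- (L n / 4)) <= (2 + K * (`|lambda| + 1)) * (32 / L n ^+ 2).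
  rewrite ler_wpM2l // addr_ge0 // mulr_ge0 ?(ltW K0) //; lra.
move: (beta _) (expR _) (L n ^+ 2)^-1 => b x y; lra.
Unshelve. all: by end_near.
Qed.

Lemma gumbel_cdf_modulus (x e : R) : {for x, continuous (@gumbel_cdf R)} -> 0 < e ->
  exists eta, [/\ 0 < eta, eta <= 1 - ln 2 &
    gumbel_cdf x - e <= gumbel_cdf (x - 16 * eta) /\
    gumbel_cdf (x + 16 * eta) <= gumbel_cdf x + e].
Proof.
move=> gx e0.
have [t /= t0 Ht] : \forall y \near x, `|gumbel_cdf x - gumbel_cdf y| <= e.
  exact: (cvgr_dist_le _ _ gx).
have l1 : 0 < 1 - ln 2 :> R by rewrite subr_gt0 ln2_lt1.
(* 16 * eta is then at most t / 2. *)
pose eta := Num.min (t / 32) (1 - ln 2).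
have eta0 : 0 < eta by rewrite lt_min l1 divr_gt0.
have etat : 16 * eta < t.
  have : eta <= t / 32 by rewrite ge_min lexx.
  lra.
have B y : `|x - y| <= 16 * eta -> `|gumbel_cdf x - gumbel_cdf y| <= e.
  by move=> xy; apply: Ht => /=; apply: le_lt_trans etat.
exists eta; split => //; first by rewrite ge_min lexx orbT.
have h1 : `|x - (x - 16 * eta)| <= 16 * eta by rewrite opprB addrC subrK gtr0_norm // mulr_gt0.
have h2 : `|x - (x + 16 * eta)| <= 16 * eta.
  by rewrite opprD addNKr normrN gtr0_norm // mulr_gt0.
have := B _ h1; have := B _ h2; rewrite !ler_norml.
move: (gumbel_cdf x) (gumbel_cdf (x - _)) (gumbel_cdf (x + _)) => g0 g1 g2.
by move=> /andP[a1 a2] /andP[a3 a4]; split; lra.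
Qed.

(** On a likely event G_star0 is, up to a multiple of eta, the position of the
    maximum on the scale on which U (n e^x) has coordinate x. *)
Lemma whp_G_star0_max (eta x : R) : 0 < eta -> eta <= 1 - ln 2 ->
  whp P (fun n => [set w |
    (order_stat X n n w <= W (s n + (L n + (x - 16 * eta))) -> G n w <= x) /\
    (W (s n + (L n + (x + 16 * eta))) <= order_stat X n n w -> x < G n w)]).
Proof.
move=> e0 e1.
have l1 := ln2_lt1 R; have lh := ln2_ge_half R.
have [K K0 HK] := scaled_increments.
have [C C0 HC] := increment_error_bound K0.
have far y : \forall n \near \oo,
    `|W (s n + (L n + y)) - W (s n) - alpha (s n) * (L n + y)| <= eta * alpha (s n).
  exact: (@far_increment R W alpha beta K K0 HK (alpha_gt0 a_gt0 SO) (beta_gt0 SO)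
    (beta_growth rho_le0 SO) s L _ y eta (log_spacing_cvgy k_gt0 k_small) (log_rank_cvgy k_gt0 k_infty) beta_bound e0).
have near_n : \forall n \near \oo,
   [/\ [/\ forall v, `|v| <= 1 -> `|W (s n + v) - W (s n) - alpha (s n) * v| <= K * (alpha (s n) * beta (s n)),
       0 < alpha (s n),
       2 * expR (- (L n / 4)) + K * beta (s n) <= C / L n ^+ 2,
       2 * expR (- (L n / 4)) <= 1 - ln 2 & (k n)%:R^-1 <= eta],
     [/\ C / L n ^+ 2 <= eta, 8 * (C / L n ^+ 2) <= 1 &
       2 * (C / L n ^+ 2) * `|L n + ln 2 / 2 + x| <= eta],
     `|W (s n + (L n + (x - 16 * eta))) - W (s n) - alpha (s n) * (L n + (x - 16 * eta))| <= eta * alpha (s n)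
   & `|W (s n + (L n + (x + 16 * eta))) - W (s n) - alpha (s n) * (L n + (x + 16 * eta))| <= eta * alpha (s n)].
  have d0 : 0 < (1 - ln 2) / 2 :> R by lra.
  near=> n; split; [split|split|by near: n; exact: far|by near: n; exact: far].
  - have h : forall v, `|v| <= 1 ->
      [/\ `|W (s n + v) - W (s n) - alpha (s n) * v| <= K * (alpha (s n) * beta (s n)),
      `|alpha (s n + v) - alpha (s n)| <= K * (alpha (s n) * beta (s n))
      & beta (s n + v) <= K * beta (s n)] by near: n; exact: (near_log_spacing k_gt0 k_small HK).
    by move=> v /h[].
  - by near: n; exact: (near_log_spacing k_gt0 k_small (alpha_gt0 a_gt0 SO)).
  - by near: n.
  - have : expR (- (L n / 4)) < (1 - ln 2) / 2.
      by near: n; exact: (expR_log_rank_small k_gt0 k_infty d0).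
    lra.
  - rewrite invf_ple ?posrE ?ltr0n //; near: n; exact: k_infty_ge.
  - have L1 : 1 + C / eta < L n by near: n; exact: (near_log_rank_gt k_gt0 k_infty).
    have Ce : 0 < C / eta by rewrite divr_gt0.
    have L0 : 0 < L n by lra.
    rewrite ler_pdivrMr ?exprn_gt0 // mulrC -ler_pdivrMr // expr2.
    apply: (@le_trans _ _ (1 * L n)); first lra.
    by rewrite ler_wpM2r //; lra.
  - have L1 : 1 + 8 * C < L n by near: n; exact: (near_log_rank_gt k_gt0 k_infty).
    have L0 : 0 < L n by lra.
    rewrite mulrA ler_pdivrMr ?exprn_gt0 // mul1r expr2.
    apply: (@le_trans _ _ (1 * L n)); first lra.
    by rewrite ler_wpM2r //; lra.
  - have L1 : 4 * C / eta + `|x| + 1 < L n by near: n; exact: (near_log_rank_gt k_gt0 k_infty).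
    have Ce : 0 < 4 * C / eta by rewrite divr_gt0 // mulr_gt0.
    have x0 := normr_ge0 x.
    have L0 : 0 < L n by lra.
    apply: (@le_trans _ _ (2 * (C / L n ^+ 2) * (2 * L n))).
      rewrite ler_wpM2l ?mulr_ge0 ?invr_ge0 ?sqr_ge0 ?(ltW C0) //.
      rewrite ler_norml; have := ler_norm x; have := ler_norm (- x); rewrite normrN.
      by move=> ? ?; apply/andP; split; lra.
    have -> : 2 * (C / L n ^+ 2) * (2 * L n) = 4 * C / L n by field; rewrite gt_eqF.
    rewrite ler_pdivrMr // [leRHS]mulrC -ler_pdivrMr //; lra.
(* The profile is taken with mesh eta / 4, whence errors of eta / 2. *)
have e4 : 0 < eta / 4 by rewrite divr_gt0.
have zero_arg : - ln 2 <= (0 : R) <= 0 by apply/andP; split; lra.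
have ln2_arg : - ln 2 <= (- ln 2 : R) <= 0 by apply/andP; split; lra.
have lh1 : 2^-1 <= (ln 2 : R) <= 1 by apply/andP; split; lra.
have eta20 : 0 < 2 * (eta / 4) by lra.
have eta2 : 2 * (eta / 4) <= 1 - ln 2 by lra.
have log_arg n r : (k n <= r <= 2 * k n)%N -> - ln 2 <= - ln (r%:R / (k n)%:R : R) <= 0.
  move=> /andP[kr r2k]; have k0R : 0 < (k n)%:R :> R by rewrite ltr0n.
  have r0R : 0 < r%:R :> R by rewrite ltr0n (leq_trans _ kr).
  rewrite lerN2 oppr_le0; apply/andP; split.
    by rewrite ler_ln ?posrE ?divr_gt0 // ler_pdivrMr // -natrM ler_nat.
  by rewrite ln_ge0 // ler_pdivlMr // mul1r ler_nat.
have prof := whp_profile X_iid k_gt0 k_infty k_small e4.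
have bands := whp_two_bands X_iid k_gt0 k_infty k_small.
have := whpI (whp_near P near_n) (whpI bands prof).
move=> /whpS; apply; apply: nearW => n w /=.
set dl := expR (- (L n / 4)); set eps := C / L n ^+ 2; set al := alpha (s n); set be := beta (s n).
move=> [[[incr al0 err dl1 kinv] [epsE eps8 epsx] far1 far2] [[bA bB] pr]].
have dl0 : 0 < dl by exact: expR_gt0.
have be0 : 0 <= be by exact: normr_ge0.
have kb0 : 0 <= K * be by rewrite mulr_ge0 // ltW.
have eps0 : 0 < eps by apply: lt_le_trans err; apply: ltr_pwDl => //; rewrite mulr_gt0.
have alerr : al * (2 * dl) + K * (al * be) <= eps * al.
  have -> : al * (2 * dl) + K * (al * be) = (2 * dl + K * be) * al by ring.
  by rewrite ler_wpM2r // ltW.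
have kerr : K * (al * be) <= eps * al.
  by apply: le_trans alerr; rewrite lerDr mulr_ge0 ?(ltW al0) // mulr_ge0 // ltW.
have dl20 : 0 < 2 * dl by rewrite mulr_gt0.
have hA : `|os (k n) n w - (W (s n) + al * 0)| <= eps * al.
  have [v1 v2] := small_shift lh zero_arg dl20 dl1.
  apply: le_trans alerr; apply: (approx_of_bounds (lo := W (s n - 2 * dl)) (hi := W (s n + 2 * dl)) bA).
    by rewrite sub0r; apply: incr; rewrite -[- _]sub0r.
  by rewrite add0r; apply: incr; rewrite -[_ * _]add0r.
have hB : `|os (2 * k n) n w - (W (s n) + al * (- ln 2))| <= eps * al.
  have [v1 v2] := small_shift lh ln2_arg dl20 dl1.
  by apply: le_trans alerr; apply: (approx_of_bounds bB); apply: incr.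
have hr r : (k n <= r <= 2 * k n)%N ->
    `|os r n w - (W (s n) + al * (- ln (r%:R / (k n)%:R)))| <= al * (2 * (eta / 4)) + eps * al.
  move=> krk; have ybd := pr r krk; have yarg := log_arg n r krk.
  have [v1 v2] := small_shift lh yarg eta20 eta2.
  apply: (le_trans (approx_of_bounds ybd (incr _ v1) (incr _ v2))).
  by rewrite lerD2l.
have hD : `|os (k n) n w - os (2 * k n) n w - al * ln 2| <= 2 * eps * al.
  have := approx_sub hA hB; rewrite sub0r opprK => /le_trans; apply.
  by rewrite -mulrA mulr2n mulrDl mul1r.
have hS : `|lower_spread X n (k n) w - al * (ln 2 ^+ 2 / 2)| <= 4 * eta * al.
  have E0 : 0 <= eps * al + (al * (2 * (eta / 4)) + eps * al).
    have ea : 0 <= eps * al by rewrite mulr_ge0 // ltW.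
    by rewrite !addr_ge0 // mulr_ge0 // ltW.
  have E1 r : (k n <= r <= 2 * k n)%N -> `|os (k n) n w - os r n w - al * ln (r%:R / (k n)%:R)| <=
      eps * al + (al * (2 * (eta / 4)) + eps * al).
    by move=> /hr h; have := approx_sub hA h; rewrite sub0r opprK.
  apply: (le_trans (lower_spread_approx (k_gt0 n) (ltW al0) E0 E1)).
  by apply: lower_spread_error => //; [rewrite ler_pM2l|rewrite ler_pM2r].
have [R1 R2] := ratio_error (order_stat X n n w - os (k n) n w) lh1 e0 al0 (ltW eps0) eps8 epsx hD hS.
rewrite G_star0E // -/(L n); split=> hM.
- apply: R1; have /andP[_ +] := far_increment_recentered al0 epsE hA far1.
  have -> : L n + x + - (16 * eta) + 2 * eta = L n + x - 14 * eta by ring.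
  by apply: le_trans; rewrite lerD2r.
- apply: R2; have /andP[+ _] := far_increment_recentered al0 epsE hA far2.
  have -> : L n + x + 16 * eta - 2 * eta = L n + x + 14 * eta by ring.
  by move=> /le_trans; apply; rewrite lerD2r.
Unshelve. all: by end_near.
Qed.

Lemma G_star0_cvg_gumbel :
  cvg_in_distribution P (fun n w => G n w) (@gumbel_cdf R).
Proof.
move=> x gx; apply: cvg_prob.
- by move=> n; exact: measurable_G_le.
- move=> e e0; have e20 : 0 < e / 2 by rewrite divr_gt0.
  have [eta [eta0 eta1 [h1 h2]]] := gumbel_cdf_modulus gx e20.
  near=> n.
  have : ((gumbel_cdf (x - 16 * eta) - e / 2)%:E <= P [set w | (G n w <= x)%R])%E.
    near: n; apply: (prob_ge_gumbel X_iid k_gt0 (E := fun n => [set w | G n w <= x]) _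
      (whp_G_star0_max x eta0 eta1) _ e20); first by move=> n; exact: measurable_G_le.
    by apply: nearW => n w /= [h _].
  by apply: le_trans; rewrite lee_fin; lra.
- move=> e e0; have e20 : 0 < e / 2 by rewrite divr_gt0.
  have [eta [eta0 eta1 [h1 h2]]] := gumbel_cdf_modulus gx e20.
  near=> n.
  have : (P [set w | (G n w <= x)%R] <= (gumbel_cdf (x + 16 * eta) + e / 2)%:E)%E.
    near: n; apply: (prob_le_gumbel X_iid k_gt0 (E := fun n => [set w | G n w <= x]) _
      (whp_G_star0_max x eta0 eta1) _ e20); first by move=> n; exact: measurable_G_le.
    apply: nearW => n w /= [_ h]; rewrite [X in _ -> is_true X]ltNge.
    by apply: contraTN => /h; rewrite -ltNge.
  by move=> /le_trans; apply; rewrite lee_fin; lra.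
Unshelve. all: by end_near.
Qed.

End Gumbel.

(** * Trichotomy *)

Theorem theorem6 (R : realType) (d : measure_display) (T : measurableType d)
    (P : probability T R) (X : nat -> {RV P >-> R}) (F : R -> R)
    (gamma rho : R) (a A0 : R -> R) (k : nat -> nat) (lambda : R)
    (X_iid : iid X F)
    (F_doa : domain_of_attraction F gamma)
    (U_first : first_order (tail_quantile F) gamma a)
    (rho_le0 : rho <= 0)
    (U_second : second_order (tail_quantile F) gamma rho a A0)
    (k_gt0 : forall n, (0 < k n)%N)
    (k_infty : k n @[n --> \oo] --> \oo)
    (k_small : (k n)%:R / n%:R @[n --> \oo] --> (0 : R))
    (k_A0 : Num.sqrt (k n)%:R * A0 (n%:R / (k n)%:R) @[n --> \oo] --> lambda) :
  [/\ gamma = 0 ->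
        cvg_in_distribution P (fun n => G_star0 X n (k n)) (@gumbel_cdf R),
      0 < gamma ->
        cvg_in_probability_pinfty P (fun n => G_star0 X n (k n))
    & gamma < 0 ->
        cvg_in_probability_ninfty P (fun n => G_star0 X n (k n))].
Proof.
have a_gt0 : forall t, 1 < t -> 0 < a t by case: U_first.
split=> [g0|g0|g0].
- move: U_second; rewrite g0 => SO.
  exact: (G_star0_cvg_gumbel X_iid k_gt0 k_infty k_small rho_le0 a_gt0 SO k_A0).
- exact: (G_star0_pinfty X_iid k_gt0 k_infty k_small (lt0r_neq0 g0) U_first g0).
- exact: (G_star0_ninfty X_iid k_gt0 k_infty k_small (ltr0_neq0 g0) U_first g0).
Qed.
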